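(* Let $V\in C^2(\mathbb{T}^d)$ with $\max_{\mathbb{T}^d}V=0$, let $u:\mathbb{T}^d\to\mathbb{R}$ be a semiconcave viscosity solution of $\frac12|Du(x)|^2+V(x)=0$ on $\mathbb{T}^d$, and set $\delta(V):=\max_{\mathbb{T}^d}V-\min_{\mathbb{T}^d}V$ and $M(V)=\mathrm{argmax}_{\mathbb{T}^d}V$. Let $x\in\mathbb{T}^d$ be such that $\sigma_u(x)=\infty$. Then the following properties are equivalent: (a) there exists $\mu\in\mathcal{X}_u(x)$ such that $\int_{\mathbb{T}^d}V(y)\,d\mu(y)<0$; (b) $\delta(V)>0$ and there exists a constant $\eta>0$ such that $$\limsup_{T\to\infty}\frac1T\,\mathcal{L}^1\Big(\Big\{t\in[0,T]:\tfrac12\big|p_0\big(\mathbf{x}_u(t,x)\big)\big|^2+V\big(\mathbf{x}_u(t,x)\big)+\eta\le0\Big\}\Big)\ge\frac{\eta}{\delta(V)};$$ (c) there exists a constant $\delta>0$ such that $$\limsup_{T\to\infty}\frac1T\,\mathcal{L}^1\Big(\big\{t\in[0,T]:d_{M(V)}\big(\mathbf{x}_u(t,x)\big)\ge\delta\big\}\Big)>0.$$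
   Context: $\mathbb{T}^d=\mathbb{R}^d/\mathbb{Z}^d$ is the flat torus; functions on $\mathbb{T}^d$ are identified with their $\mathbb{Z}^d$-periodic extensions to $\mathbb{R}^d$. A continuous $u:\mathbb{T}^d\to\mathbb{R}$ is semiconcave if there is $C>0$ with $\lambda u(x)+(1-\lambda)u(y)-u(\lambda x+(1-\lambda)y)\le \frac C2\lambda(1-\lambda)|x-y|^2$ for all $x,y$ and $\lambda\in[0,1]$. The superdifferential is $D^+u(x)=\{p\in\mathbb{R}^d:\limsup_{y\to x}\frac{u(y)-u(x)-\langle p,y-x\rangle}{|y-x|}\le0\}$ (nonempty, convex, compact for semiconcave $u$) and the subdifferential is $D^-u(x)=\{p\in\mathbb{R}^d:\liminf_{y\to x}\frac{u(y)-u(x)-\langle p,y-x\rangle}{|y-x|}\ge0\}$. $p_0(y)$ denotes the unique element of minimal Euclidean norm of $D^+u(y)$. $u$ is a viscosity solution of $\frac12|Du|^2+V=0$ if $\frac12|p|^2+V(x)\le0$ for all $x$ and $p\in D^+u(x)$, and $\frac12|p|^2+V(x)\ge0$ for all $x$ and $p\in D^-u(x)$. $\mathrm{Sing}(u)$ is the set of points where $u$ is not differentiable, $\mathrm{Crit}(u)=\{x:0\in D^+u(x)\}$, $\mathrm{Crit}^*(u)=\mathrm{Crit}(u)\setminus\mathrm{Sing}(u)$; it is known that $\mathrm{Crit}^*(u)=\mathrm{argmax}_{\mathbb{T}^d}V$. The generalized gradient flow $\mathbf{x}_u(\cdot,x):[0,\infty)\to\mathbb{T}^d$ is the unique locally Lipschitz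 solution of $\dot{\mathbf{x}}(t)\in D^+u(\mathbf{x}(t))$ for a.e. $t\ge0$, $\mathbf{x}(0)=x$. The critical time is $\sigma_u(x)=\inf\{t\ge0:\mathbf{x}_u(t,x)\in\mathrm{Crit}(u)\}\in[0,\infty]$ (with $\inf\varnothing=\infty$). For $T>0$, $\mu^T_x$ is the probability measure on $\mathbb{T}^d$ with $\int f\,d\mu^T_x=\frac1T\int_0^Tf(\mathbf{x}_u(t,x))\,dt$ for all $f\in C(\mathbb{T}^d)$. $\mathcal{X}_u(x)$ is the set of occupational measures from $x$: all probability measures $\mu$ on $\mathbb{T}^d$ for which there is a sequence $T_k\uparrow\infty$ with $\mu^{T_k}_x\rightharpoonup\mu$ (i.e. $\int f\,d\mu_x^{T_k}\to\int f\,d\mu$ for all $f\in C(\mathbb{T}^d)$). $d_S(y)$ is the (flat, Euclidean) distance of $y$ from the closed set $S$; $\mathcal{L}^1$ is one-dimensional Lebesgue measure. *)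

(* Defs.v *)
From HB Require Import structures.
From mathcomp Require Import all_boot all_order all_algebra.
From mathcomp Require Import all_classical all_reals all_analysis.
Set Implicit Arguments.
Unset Strict Implicit.
Unset Printing Implicit Defensive.
Import Order.TTheory GRing.Theory Num.Theory.
Import numFieldNormedType.Exports.
Local Open Scope quotient_scope.
Local Open Scope classical_set_scope.
Local Open Scope ring_scope.

Definition torus_rel (R : realType) (d : nat) : rel 'rV[R]_d :=
  fun a b => [forall i, a 0 i - b 0 i \is a Num.int].

Lemma torus_rel_refl (R : realType) (d : nat) : reflexive (@torus_rel R d).
Proof. by move=> a; apply/forallP => i; rewrite subrr. Qed.

Lemma torus_rel_sym (R : realType) (d : nat) : symmetric (@torus_rel R d).
Proof.
by move=> a b; apply/forallP/forallP => h i; rewrite -opprB rpredN.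
Qed.

Lemma torus_rel_trans (R : realType) (d : nat) : transitive (@torus_rel R d).
Proof.
move=> b a c /forallP ab /forallP bc; apply/forallP => i.
by rewrite -(subrK (b 0 i) (a 0 i)) -addrA rpredD.
Qed.

Canonical torus_equiv (R : realType) (d : nat) : equiv_rel 'rV[R]_d :=
  EquivRel (@torus_rel R d) (@torus_rel_refl R d) (@torus_rel_sym R d)
    (@torus_rel_trans R d).

(* The flat torus R^d / Z^d, with the quotient topology and the Borel
   sigma-algebra. *)
Definition torus (R : realType) (d : nat) : Type :=
  quotient_topology {eq_quot (torus_equiv R d)}.

HB.instance Definition _ (R : realType) (d : nat) :=
  PointedTopological.copy (torus R d)
    (quotient_topology {eq_quot (torus_equiv R d)}).
HB.instance Definition _ (R : realType) (d : nat) :=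
  Quotient.copy (torus R d) {eq_quot (torus_equiv R d)}.
HB.instance Definition _ (R : realType) (d : nat) :=
  Measurable.copy (torus R d) (g_sigma_algebraType (@open (torus R d))).


Definition torus_pi (R : realType) (d : nat) (a : 'rV[R]_d) : torus R d :=
  \pi_(torus R d) a.

Definition periodic_ext (R : realType) (d : nat) (f : torus R d -> R)
  : 'rV[R]_d -> R := f \o @torus_pi R d.

(* The library norm on 'rV[R]_d is the sup norm; the Euclidean structure is
   given by [dot] and [enorm]. *)
Definition dot (R : realType) (d : nat) (p q : 'rV[R]_d) : R :=
  \sum_(i < d) p 0 i * q 0 i.

Definition enorm (R : realType) (d : nat) (p : 'rV[R]_d) : R :=
  Num.sqrt (dot p p).

(* Flat distance to [S]: infimum of Euclidean distances over all lifts. *)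
Definition torus_dist (R : realType) (d : nat) (S : set (torus R d))
    (y : torus R d) : R :=
  inf [set enorm (a - b) | a in @torus_pi R d @^-1` [set y] & b in @torus_pi R d @^-1` S].

(* Existence and continuity of all iterated partial derivatives of order at
   most [k]. *)
Fixpoint class_C (R : realType) (d k : nat) (f : 'rV[R]_d -> R) : Prop :=
  continuous f /\
  if k is k'.+1 then
    forall i : 'I_d, (forall a, derivable f a (delta_mx 0 i)) /\
      class_C k' (fun a => 'D_(delta_mx 0 i) f a)
  else True.

(* For continuous [V] the extrema below are attained, by compactness. *)
Definition torus_max (R : realType) (d : nat) (V : torus R d -> R) : R :=
  sup (range V).

Definition torus_min (R : realType) (d : nat) (V : torus R d -> R) : R :=
  inf (range V).

Definition oscillation (R : realType) (d : nat) (V : torus R d -> R) : R :=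
  torus_max V - torus_min V.

Definition argmax (R : realType) (d : nat) (V : torus R d -> R)
  : set (torus R d) := [set y | forall z, V z <= V y].

Definition semiconcave (R : realType) (d : nat) (u : torus R d -> R) : Prop :=
  continuous u /\
  exists2 C : R, 0 < C & forall (a b : 'rV[R]_d) (l : R), 0 <= l <= 1 ->
    l * periodic_ext u a + (1 - l) * periodic_ext u b
      - periodic_ext u (l *: a + (1 - l) *: b)
    <= C / 2 * l * (1 - l) * enorm (a - b) ^+ 2.

Definition diff_quotient (R : realType) (d : nat) (f : 'rV[R]_d -> R)
    (p a b : 'rV[R]_d) : R :=
  (f b - f a - dot p (b - a)) / enorm (b - a).

(* By periodicity the choice of the lift [repr y] of [y] is immaterial. *)
Definition superdiff (R : realType) (d : nat) (u : torus R d -> R)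
    (y : torus R d) : set 'rV[R]_d :=
  [set p | (limf_esup (fun b => (diff_quotient (periodic_ext u) p (repr y) b)%:E)
              (repr y)^' <= 0)%E].

Definition subdiff (R : realType) (d : nat) (u : torus R d -> R)
    (y : torus R d) : set 'rV[R]_d :=
  [set p | (0 <= limf_einf
              (fun b => (diff_quotient (periodic_ext u) p (repr y) b)%:E)
              (repr y)^')%E].

Definition min_superdiff (R : realType) (d : nat) (u : torus R d -> R)
    (y : torus R d) : 'rV[R]_d :=
  get [set p | superdiff u y p /\
               forall q, superdiff u y q -> enorm p <= enorm q].

Definition viscosity_solution (R : realType) (d : nat) (V u : torus R d -> R)
  : Prop :=
  (forall y p, superdiff u y p -> enorm p ^+ 2 / 2 + V y <= 0) /\
  (forall y p, subdiff u y p -> 0 <= enorm p ^+ 2 / 2 + V y).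

Definition Crit (R : realType) (d : nat) (u : torus R d -> R)
  : set (torus R d) := [set y | superdiff u y 0].

(* [gamma] is the curve t |-> x_u(t, x), t >= 0; its values at negative times
   are irrelevant.  The velocity of a curve in the torus is that of a lift [g]
   to R^d. *)
Definition gradient_flow (R : realType) (d : nat) (u : torus R d -> R)
    (x : torus R d) (gamma : R -> torus R d) : Prop :=
  gamma 0 = x /\
  exists g : R -> 'rV[R]_d,
    [/\ forall t : R, 0 <= t -> gamma t = torus_pi (g t),
        [locally [lipschitz g t | t in `[0, +oo[%classic]] &
        {ae lebesgue_measure, forall t : R, 0 <= t ->
           derivable g t 1 /\ superdiff u (gamma t) ('D_1 g t)}].

Definition critical_time (R : realType) (d : nat) (u : torus R d -> R)
    (gamma : R -> torus R d) : \bar R :=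
  ereal_inf [set t%:E | t in [set t : R | 0 <= t /\ Crit u (gamma t)]].

(* [nu] is the measure mu_x^T. *)
Definition time_average (R : realType) (d : nat) (gamma : R -> torus R d)
    (T : R) (nu : probability (torus R d) R) : Prop :=
  forall f : torus R d -> R, continuous f ->
    \int[nu]_y f y =
    T^-1 * \int[@lebesgue_measure R]_(t in `[0, T]) f (gamma t).

Definition occupational (R : realType) (d : nat) (gamma : R -> torus R d)
  : set (probability (torus R d) R) :=
  [set mu | exists (T : nat -> R) (nu : nat -> probability (torus R d) R),
     [/\ (forall k, 0 < T k), nondecreasing_seq T, T @ \oo --> +oo,
         forall k, time_average gamma (T k) (nu k) &
         forall f : torus R d -> R, continuous f ->
           (fun k => \int[nu k]_y f y) @ \oo --> \int[mu]_y f y]].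

(* limsup of (1/T) L^1({t in [0, T] : P t}) as T tends to infinity. *)
Definition upper_density (R : realType) (P : R -> Prop) : \bar R :=
  limf_esup (fun T : R =>
    ((T^-1)%:E * lebesgue_measure [set t : R | (0 <= t <= T)%R /\ P t])%E) +oo_R.

(* Main.v *)
Require Import Defs.
From HB Require Import structures.
From mathcomp Require Import all_boot all_order all_algebra.
From mathcomp Require Import all_classical all_reals all_analysis.
From mathcomp Require Import measurable_realfun.
From mathcomp Require Import ring lra.
Set Implicit Arguments.
Unset Strict Implicit.
Unset Printing Implicit Defensive.
Import Order.TTheory GRing.Theory Num.Theory.
Import numFieldNormedType.Exports.
Local Open Scope classical_set_scope.
Local Open Scope ring_scope.

(** Write [p] for the velocity of the flow. At almost every time [p] is a
    superdifferential of [u], and for a semiconcave function a superdifferential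
    satisfies u(b) <= u(a) + p.(b - a) + (C/2) |b - a|^2 for all [b]
    ([superdiffP]). With [b] the position at time [t - h], this compares the
    product of [p] with the backward difference quotient of the curve to the
    backward difference quotient of [u] along the curve. The integrals of the
    latter telescope, so that the integral of |p|^2 over [0, T] is bounded
    independently of [T]: the kinetic energy has mean zero, and so does the
    minimal one, |p_0|^2 <= |p|^2.

    (a) => (b). Consequently the time averages of [V] and of the Hamiltonian
    |p_0|^2 / 2 + V have the same limits. If an occupational measure gives [V] a
    negative mean, then so do these averages along a sequence of times, and since
    the Hamiltonian is between [- oscillation V] and 0, it must be at most
    [- eta] during a proportion [eta / oscillation V] of the time. The
    quantitative form is [occupation_estimate].

    (b) => (c). If the Hamiltonian is at most [- eta], then so is [V], which by
    uniform continuity only happens at some distance from its maximisers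
    ([near_argmax_gt]).

    (c) => (a). Away from its maximisers [V] is at most some [- e]
    ([far_argmax_le]), so its averages along a sequence of times are bounded away
    from 0 ([average_le_of_density]). It remains to extract a weakly convergent
    subsequence of the laws of the flow at a uniformly distributed time
    ([occupational_subsequence]).

    This last step is the sequential weak compactness of the probability measures
    on the torus ([weak_compactness]), for which a limit measure is constructed
    explicitly. Points are coded by the sequence of bits telling which sets
    of a countable base contain them. The masses of the cells of this code
    converge along a subsequence to consistent masses, which are lengths of nested
    subintervals of [0, 1); following the nested intervals that contain a number
    leads to a point of the torus, and the limit measure is the law of that point
    for a uniformly distributed number. *)

(** * Pointwise subsequences and step approximations *)

(** A cluster point of the sequence in the compact product [0, 1] ^ I gives the
    limit; since [I] is countable, a neighbourhood of it controls the first [n]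
    coordinates, and choosing terms in these shrinking neighbourhoods replaces
    the diagonal argument. *)
Lemma pointwise_subsequence (R : realType) (I : countType) (p : nat -> I -> R) :
  (forall k i, 0 <= p k i <= 1) ->
  exists (phi : nat -> nat) (m : I -> R),
    increasing_seq phi /\ forall i, (fun k => p (phi k) i) @ \oo --> m i.
Proof.
move=> p01.
have cK := @tychonoff I (fun=> R) (fun=> `[0, 1]%classic) (fun=> @segment_compact R 0 1).
have [|m [_ clm]] := cK (p @ \oo) (fmap_proper_filter _ _).
  by exists 0%N => // k _ i /=; rewrite in_itv /=.
pose M : prod_topology (fun=> R) := m.
pose A n (j : 'I_n) : set (prod_topology (fun=> R)) :=
  [set f | forall i : I, pickle i = j -> `|f i - m i| < n.+1%:R^-1].
have near_m n : \forall f \near M, forall j, A n j f.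
  apply: (@filter_forall _ _ (A n) (nbhs M) _) => j.
  have [[i0 i0j]|noi] := pselect (exists i0 : I, pickle i0 = j); last first.
    by apply: nearW => f i ij; case: noi; exists i.
  have e0 : 0 < n.+1%:R^-1 :> R by rewrite invr_gt0 ltr0n.
  have nearM : nbhs M [set f | ball (m i0) n.+1%:R^-1 (f i0)].
    exact: (@proj_continuous I (fun=> R) i0 M _ (nbhsx_ballx (m i0) _ e0)).
  apply: (@filterS _ (nbhs M) _ _ _ _ nearM) => f fi0 i ij.
  have -> : i = i0 by apply: (pcan_inj pickleK); rewrite ij i0j.
  by move: fi0; rewrite /= /ball /= distrC.
have /choice[pick pickP] (nK : nat * nat) : exists k, (nK.2 <= k)%N /\
    forall i, (pickle i < nK.1)%N -> `|p k i - m i| < nK.1.+1%:R^-1.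
  have [|f [[k Kk <-] fn]] := clm (p @` [set k | nK.2 <= k]%N) _ _ (near_m nK.1).
    by exists nK.2 => // k /= Kk; exists k.
  by exists k; split => // i iN; exact: (fn (Ordinal iN)).
(* the n-th term is 1/(n+1)-close to the limit in the first n coordinates *)
pose phi := fix phi n := pick (n, if n is n'.+1 then (phi n').+1 else 0%N).
exists phi, m; split.
  apply/increasing_seqP => n /=.
  by have [+ _] := pickP (n.+1, (phi n).+1); apply: leq_trans.
move=> i; apply/cvgrPdist_lt => e e0.
have [N _ Ne] := near_infty_natSinv_lt (PosNum e0).
exists (maxn N (pickle i).+1) => // n /=; rewrite geq_max => /andP[Nn iN].
rewrite distrC (lt_trans _ (Ne _ Nn))//.
by case: n {Nn} iN => // n iN; have [_ ->] := pickP (n.+1, (phi n).+1).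
Qed.

Section step_approximation.
Context d {T : measurableType d} {R : realType}.

Lemma Rintegral_step_approx (P : probability T R) (I : finType)
    (k : T -> I) (f : T -> R) (c : I -> R) (e : R) :
  (forall i, measurable (k @^-1` [set i])) ->
  P.-integrable setT (EFin \o f) -> (forall y, `|f y - c (k y)| <= e) ->
  `| \int[P]_y f y - \sum_i c i * fine (P (k @^-1` [set i])) | <= e.
Proof.
move=> mk intf fc.
have ckE y : c (k y) = \sum_i c i * \1_(k @^-1` [set i]) y.
  rewrite (bigD1 (k y))//= indicE mem_set//= mulr1 big1 ?addr0// => i iy.
  by rewrite indicE memNset ?mulr0//= => yi; rewrite yi eqxx in iy.
have int1 i : P.-integrable setT (EFin \o (fun y => c i * \1_(k @^-1` [set i]) y)).
  rewrite (_ : _ \o _ = fun y => ((c i)%:E * (\1_(k @^-1` [set i]) y)%:E)%E);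
    last by apply/funext => y /=; rewrite EFinM.
  by apply: integrableZl => //; exact: integrable_indic.
have intc : P.-integrable setT (EFin \o (c \o k)).
  rewrite (_ : _ \o _ = fun y =>
      (\sum_i (c i * \1_(k @^-1` [set i]) y)%:E)%E); last first.
    by apply/funext => y; rewrite /= ckE sumEFin.
  by apply: integrable_sum => // i _; exact: int1.
have -> : \sum_i c i * fine (P (k @^-1` [set i])) = \int[P]_y c (k y).
  rewrite /Rintegral; under [in RHS]eq_integral do rewrite ckE -sumEFin.
  rewrite integral_sum// -sum_fine => [|i _]; last first.
    by apply: integrable_fin_num => //; exact: int1.
  apply: eq_bigr => i _; under eq_integral do rewrite EFinM.
  rewrite integralZl//; last exact: integrable_indic.
  by rewrite integral_indic// setIT fineM// fin_num_measure.
have intfc : P.-integrable setT (EFin \o (fun y => f y - c (k y))).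
  exact: (integrableB measurableT intf intc).
rewrite -RintegralB//; apply: (le_trans (le_normr_Rintegral measurableT intfc)).
have -> : e = \int[P]_y (cst e) y.
  by rewrite Rintegral_cst// (congr1 fine (probability_setT P)) mulr1.
apply: le_Rintegral => //.
- exact: (integrable_norm intfc).
- exact: finite_measure_integrable_cst.
Qed.

End step_approximation.

(** * Binary codes of points and of numbers *)

Section cells.
Context {X : Type} (B : nat -> set X).

(** The points with a given code with respect to the tests [B 0], [B 1], ...;
    the most recent test comes first in a word, so that the tree of cells is
    built by structural recursion. *)
Fixpoint cell (w : seq bool) : set X :=
  if w is b :: w' then
    cell w' `&` (if b then B (size w') else ~` B (size w'))
  else setT.

Fixpoint code (y : X) (n : nat) : n.-tuple bool :=
  if n is n'.+1 then [tuple of `[< B n' y >] :: code y n'] else [tuple].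

Lemma cell_codeP w y : cell w y <-> code y (size w) = w :> seq bool.
Proof.
elim: w => //= b w IH; split => [[/IH -> yb]|[yb /IH]].
  by congr cons; case: b yb => yb; [apply/asboolT | apply/asboolF].
split => //.
by rewrite -yb; case: ifPn => /asboolP.
Qed.

Lemma cell_tupleE n (w : n.-tuple bool) : cell w = code^~ n @^-1` [set w].
Proof.
apply/seteqP; split => y /=; have := cell_codeP w y; rewrite size_tuple.
  by move=> [+ _] => /[apply] /val_inj.
by move=> [_ +] yw; apply; rewrite yw.
Qed.

Lemma cell_bit w i y z : (i < size w)%N -> cell w y -> cell w z ->
  B i y -> B i z.
Proof.
elim: w => //= b w IH; rewrite ltnS leq_eqVlt => /orP[/eqP ->|iw].
  by case: b => -[_ +] [_ +].
by move=> [wy _] [wz _]; exact: IH.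
Qed.

Lemma cell_head w i y : size w = i.+1 -> cell w y -> head false w <-> B i y.
Proof. by case: w => //= b w [<-] [_]; case: b; split. Qed.

End cells.

(** A consistent family of masses on binary words is realised by intervals of
    [0, 1): each word [w] receives an interval of length [m w], which is split
    between [false :: w], on the left, and [true :: w], on the right. *)
Section interval_tree.
Context {R : realType} (m : seq bool -> R).
Hypothesis m_ge0 : forall w, 0 <= m w.
Hypothesis m_nil : m [::] = 1.
Hypothesis m_split : forall w, m w = m (true :: w) + m (false :: w).

Fixpoint left_end (w : seq bool) : R :=
  if w is b :: w' then left_end w' + (if b then m (false :: w') else 0) else 0.

(** For [s] in [0, 1), the word of length [n] whose interval contains [s]. *)
Fixpoint walk (s : R) (n : nat) : n.-tuple bool :=
  if n is n'.+1 then
    [tuple of (left_end (walk s n') + m (false :: walk s n') <= s) :: walk s n']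
  else [tuple].

Lemma walk_itv s n : 0 <= s < 1 ->
  left_end (walk s n) <= s < left_end (walk s n) + m (walk s n).
Proof.
move=> s01; elim: n => [|n IH] /=; first by rewrite add0r m_nil.
by have := m_split (walk s n); move: IH; case: (leP (left_end _ + m (false :: _))); lra.
Qed.

Lemma itv_walk s w : left_end w <= s < left_end w + m w ->
  walk s (size w) = w :> seq bool.
Proof.
elim: w => //= b w IH sw.
have mw := m_split w; have := m_ge0 (true :: w); have := m_ge0 (false :: w) => f0 t0.
have {}IH : walk s (size w) = w :> seq bool by apply: IH; case: b sw; lra.
rewrite IH; congr cons.
by case: b sw => /andP[ls sl]; [rewrite ls | rewrite addr0 in sl; rewrite leNgt sl].
Qed.

Lemma left_end_bounds w : 0 <= left_end w /\ left_end w + m w <= 1.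
Proof.
elim: w => [|b w]; first by rewrite /= add0r m_nil.
have := m_split w; have := m_ge0 (true :: w); have := m_ge0 (false :: w).
by case: b => /=; lra.
Qed.

Lemma walk_itvE n (w : n.-tuple bool) s : 0 <= s < 1 ->
  walk s n = w <-> left_end w <= s < left_end w + m w.
Proof.
move=> s01; split => [<-|/itv_walk]; first exact: walk_itv.
by rewrite size_tuple => /val_inj.
Qed.

Lemma measurable_walk n (w : n.-tuple bool) :
  measurable (walk^~ n @^-1` [set w]).
Proof.
elim: n w => [|n IH] w.
  rewrite (_ : _ @^-1` _ = setT)//.
  by apply/seteqP; split => // s _ /=; apply/val_inj; rewrite (tuple0 w).
have [b [v ->]] : exists b (v : n.-tuple bool), w = [tuple of b :: v].
  by exists (thead w), (behead_tuple w); exact: tuple_eta.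
rewrite (_ : _ @^-1` _ = walk^~ n @^-1` [set v] `&`
    (if b then `[left_end v + m (false :: v), +oo[%classic
     else `]-oo, left_end v + m (false :: v)[%classic)).
  by apply: measurableI; [exact: IH | case: b].
apply/seteqP; split => s /=.
  move=> /(congr1 val) [bE /val_inj <-]; split => //.
  by move: bE; case: b => bE; rewrite /= in_itv/= ?andbT// ltNge bE.
move=> [<-] sb; apply/val_inj => /=; congr cons; move: sb.
by case: b; rewrite /= in_itv/= ?andbT//; case: leP.
Qed.

End interval_tree.

(** * Weak compactness of probability measures *)

Lemma uniform_prob01E (R : realType) (A : set R) : measurable A ->
  uniform_prob (@ltr01 R) A = lebesgue_measure (A `&` `[0, 1[%classic).
Proof.
move=> mA; transitivity (\int[uniform_prob (@ltr01 R)]_s (\1_A s)%:E)%E.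
  by rewrite integral_indic// setIT.
rewrite integral_uniform//; last exact/measurable_EFinP/measurable_indic.
rewrite subr0 invr1 mul1e integral_indic//.
rewrite (_ : A `&` `[0, 1] = A `&` `[0, 1[%classic `|` A `&` [set 1]).
  rewrite measureU0//; [exact: measurableI| exact: measurableI|].
  apply/eqP; rewrite eq_le measure_ge0 andbT -(lebesgue_measure_set1 1).
  by apply: le_measure; rewrite ?inE//; exact: measurableI.
by rewrite -setIUr setUitv1//= bnd_simp.
Qed.

(** Probability measures on a compact space, for the Borel sets; [B] is a
    countable base, regular in the sense that the closures of its members still
    form a base at each point. *)
Section weak_compactness.
Context {R : realType} {X : ptopologicalType}.
Local Notation borel := (g_sigma_algebraType (@open X)).

Lemma open_borel (U : set X) : open U -> measurable (U : set borel).
Proof. exact: sub_sigma_algebra. Qed.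

Lemma continuous_borel (f : X -> R) : continuous f ->
  measurable_fun setT (f : borel -> R).
Proof.
move=> /continuousP cf; apply: (measurability _ (RGenOpens.measurableE R)).
move=> _ [_ [a [b ->] <-]]; rewrite setTI; apply: open_borel; apply: cf.
exact: interval_open.
Qed.

Hypothesis cptX : compact [set: X].

Lemma continuous_bounded (f : X -> R) : continuous f -> [bounded f y | y in setT].
Proof.
move=> cf.
have : compact (f @` setT).
  by apply: continuous_compact => //; exact: continuous_subspaceT.
move=> /compact_bounded [M [Mr fM]]; exists M; split => // r Mr' y _.
by apply: (fM r Mr'); exists y.
Qed.

Lemma continuous_integrable (P : probability borel R) (f : X -> R) :
  continuous f -> P.-integrable setT (EFin \o f).
Proof.
move=> cf; apply: measurable_bounded_integrable => //.
- by apply: le_lt_trans (ltry 1); exact: probability_le1.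
- exact: continuous_borel.
- exact: continuous_bounded.
Qed.

Variable B : nat -> set X.
Hypothesis Bopen : forall n, open (B n).
Hypothesis Breg : forall U y, open U -> U y ->
  exists2 n, B n y & closure (B n) `<=` U.

Lemma measurable_cell w : measurable (cell B w : set borel).
Proof.
elim: w => [|b w IH]; first exact: measurableT.
apply: measurableI => //; case: b; first exact: open_borel.
by apply: measurableC; exact: open_borel.
Qed.

(** Two points with the same long code are not separated by [f]: by compactness
    finitely many of the tests already cover the space by sets on which [f]
    oscillates little. *)
Lemma continuous_cell_osc (f : X -> R) (e : R) : continuous f -> 0 < e ->
  exists N, forall w y z, (N <= size w)%N -> cell B w y -> cell B w z ->
    `|f y - f z| <= e.
Proof.
move=> cf e0.
have /compact_near_coveringP/(_ nat \oo (fun N y => forall w z,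
    (N <= size w)%N -> cell B w y -> cell B w z -> `|f y - f z| <= e)) := cptX.
case=> [y _|N _ hN].
  have e20 : 0 < e / 2 by rewrite divr_gt0.
  have /cvgrPdist_lt/(_ _ e20) := cf y.
  rewrite /prop_near1 nbhsE => -[U [oU Uy] fU].
  have [i Biy BiU] := Breg oU Uy.
  exists (B i, [set n | i < n]%N) => /=.
    by split; [exact: open_nbhs_nbhs | exists i.+1].
  move=> [y' n] [/= By' ni] w z nw wy wz.
  have Bz : B i z by apply: (cell_bit (leq_trans ni nw) wy wz).
  have BU z' : B i z' -> `|f y - f z'| < e / 2.
    by move=> /subset_closure/BiU/fU.
  have := ler_distD (f y) (f y') (f z); rewrite (distrC (f y') (f y)) => /le_trans; apply.
  by rewrite (splitr e) lerD// ltW// BU.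
by exists N => w y z; exact: (hN N (leqnn N) y I w z).
Qed.

(** The masses of all cells converge along a subsequence. The limit masses are
    again consistent, hence realised by intervals, and the map [q] that sends a
    number of [0, 1) to a point in the closures of all its cells transports the
    uniform law to the limit measure. Up to the oscillation of [f] on long
    cells, integrals of [f] are finite combinations of cell masses, so they
    converge. *)
Theorem weak_compactness (P : nat -> probability borel R) :
  exists (phi : nat -> nat) (mu : probability borel R), increasing_seq phi /\
    forall f : X -> R, continuous f ->
      (fun k => \int[P (phi k)]_y f y) @ \oo --> \int[mu]_y f y.
Proof.
pose p k w := fine (P k (cell B w)).
have p01 k w : 0 <= p k w <= 1.
  rewrite fine_ge0//= -lee_fin fineK ?fin_num_measure//; last exact: measurable_cell.
  by apply: probability_le1; exact: measurable_cell.
have [phi [m [phi_inc pm]]] := pointwise_subsequence p01.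
have m_ge0 w : 0 <= m w.
  have : cvg (p (phi k) w @[k --> \oo]) by apply/cvg_ex; exists (m w); exact: pm.
  rewrite -(cvg_lim _ (pm w))//; move/limr_ge; apply; apply: nearW => k.
  by have /andP[] := p01 (phi k) w.
have m_nil : m [::] = 1.
  apply: cvg_unique (pm [::]) _ => //.
  rewrite (_ : (fun _ => _) = cst 1); first exact: cvg_cst.
  by apply/funext => k; rewrite /p /= (congr1 fine (probability_setT _)).
have m_split w : m w = m (true :: w) + m (false :: w).
  apply: cvg_unique (pm w) _ => //.
  rewrite (_ : (fun _ => _) =
      (fun k => p (phi k) (true :: w) + p (phi k) (false :: w))).
    by apply: cvgD; exact: pm.
  apply/funext => k; rewrite /p -fineD ?fin_num_measure//; try exact: measurable_cell.
  rewrite -measureU; try exact: measurable_cell.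
    by rewrite /= -setIUr setUv setIT.
  by rewrite /= setIACA setICr setI0.
(* outside [0, 1), a null set, the number 0 is used instead *)
pose r (s : R) : R := if 0 <= s < 1 then s else 0.
have r01 s : 0 <= r s < 1 by rewrite /r; case: ifPn => //; rewrite lexx ltr01.
pose W s n := walk m (r s) n.
(* the interval of a visited word has positive length, so its cell is charged
   by some of the measures and cannot be empty *)
have cellW s n : cell B (W s n) !=set0.
  have mW : 0 < m (W s n).
    have := walk_itv m_nil m_split n (r01 s).
    by move=> /andP[] /le_lt_trans /[apply]; rewrite ltrDl.
  have [k _ /(_ k (leqnn k))/= pk] := cvgr_gt _ (pm _) _ mW.
  apply/set0P/eqP => W0; move: pk; rewrite /p W0 measure0 ltxx//.
have W_sub s n n' : (n <= n')%N -> cell B (W s n') `<=` cell B (W s n).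
  elim: n' => [|k IH]; first by rewrite leqn0 => /eqP ->.
  rewrite leq_eqVlt => /predU1P[->//|]; rewrite ltnS => /IH.
  by apply: subset_trans; exact: subIsetl.
have /choice[q qW] s : exists y, forall n, closure (cell B (W s n)) y.
  have [y0 y0W] := choice (cellW s).
  have [|y [_ cly]] := cptX (fmap_proper_filter y0 eventually_filter).
    by exists 0%N.
  exists y => n U nU; apply: cly nU; exists n => //= k nk.
  by apply: W_sub nk _ _; exact: y0W.
have q_head i s : [\/ B i (q s) -> thead (W s i.+1) | True] by right.
have B_head s i : B i (q s) -> head false (W s i.+1).
  move=> Biq; have [z [Wz Biz]] := qW s i.+1 _ (open_nbhs_nbhs (conj (Bopen i) Biq)).
  exact: (cell_head (size_tuple _) Wz).2.
have head_B s i : head false (W s i.+1) -> closure (B i) (q s).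
  move=> h; apply: closure_subset (qW s i.+1) => z Wz.
  exact: (cell_head (size_tuple _) Wz).1.
have mr : measurable_fun setT r.
  apply: measurable_fun_ifT => //=.
  apply: (measurable_fun_bool true); rewrite setTI.
  rewrite (_ : _ @^-1` _ = `[0, 1[%classic)//.
have mW n (w : n.-tuple bool) : measurable (W^~ n @^-1` [set w]).
  by rewrite -[_ @^-1` _]setTI; exact: (mr measurableT _ (measurable_walk m w)).
(* q s belongs to an open set U exactly when some test B i whose closure lies
   in U is passed by the code of s *)
have mq : measurable_fun setT (q : R -> borel).
  apply: (@measurability _ _ _ borel _ q (@open X)) => //.
  move=> _ [U oU <-]; rewrite setTI.
  rewrite (_ : q @^-1` U = \bigcup_(i in [set i | closure (B i) `<=` U])
      \bigcup_(w in [set w : i.+1.-tuple bool | head false w]) W^~ i.+1 @^-1` [set w]).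
    by apply: bigcup_measurable => i _; apply: fin_bigcup_measurable.
  apply/seteqP; split => s.
    move=> /(Breg oU)[i Bi BiU]; exists i => //; exists (W s i.+1) => //=.
    exact: B_head.
  by move=> [i BiU [w wh /= sw]]; apply: BiU; apply: head_B; rewrite sw.
pose Q : {mfun measurableTypeR R >-> borel} := HB.pack
  (q : measurableTypeR R -> borel)
  (isMeasurableFun.Build _ _ (measurableTypeR R) borel q mq).
pose U : probability (measurableTypeR R) R := uniform_prob (@ltr01 R).
pose mu : probability borel R := distribution U Q.
have UW n (w : n.-tuple bool) : fine (U (W^~ n @^-1` [set w])) = m w.
  rewrite (uniform_prob01E (mW n w) : U _ = _).
  rewrite (_ : _ `&` _ = `[left_end m w, left_end m w + m w[%classic).
    rewrite lebesgue_measure_itv/= lte_fin ltrDl; case: ltP => [_|mw].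
      by rewrite -EFinB /= addrAC subrr add0r.
    by apply/eqP; rewrite eq_le m_ge0.
  have [l0 l1] := left_end_bounds m_ge0 m_nil m_split w.
  have rE s : 0 <= s < 1 -> r s = s by rewrite /r => ->.
  apply/seteqP; split => s; rewrite /= !in_itv /=.
    move=> [Ww s01]; rewrite -(rE s s01).
    exact: (walk_itvE m_ge0 m_nil m_split w (r01 s)).1.
  move=> ws; have s01 : 0 <= s < 1 by lra.
  by split => //; apply: (walk_itvE m_ge0 m_nil m_split w (r01 s)).2; rewrite rE.
exists phi, mu; split => // f cf.
apply/cvgrPdist_le => e e0; have e30 : 0 < e / 3 by rewrite divr_gt0.
have [N fN] := continuous_cell_osc cf e30.
pose c (w : N.-tuple bool) : R := f (get (cell B w)).
pose S (p : N.-tuple bool -> R) := \sum_w c w * p w.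
have cN (w : N.-tuple bool) y : cell B w y -> `|f y - c w| <= e / 3.
  move=> wy; apply: (fN w) => //; first by rewrite size_tuple.
  by apply: getI wy.
have intfq : U.-integrable setT (EFin \o (f \o q)).
  apply: measurable_bounded_integrable => //.
  - by apply: le_lt_trans (ltry 1); exact: probability_le1.
  - exact: (measurableT_comp (continuous_borel cf) mq).
  - have [M [Mr fM]] := continuous_bounded cf.
    by exists M; split => // M' MM' s _; exact: (fM M' MM').
have muS : `|\int[mu]_y f y - S m| <= e / 3.
  have -> : \int[mu]_y f y = \int[U]_s f (q s).
    rewrite /Rintegral; congr fine; apply: integral_distribution.
      by apply/measurable_EFinP; exact: continuous_borel cf.
    exact: intfq.
  have -> : S m = \sum_w c w * fine (U (W^~ N @^-1` [set w])).
    by apply: eq_bigr => w _; rewrite (UW N w).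
  apply: Rintegral_step_approx => //; first exact: mW.
  move=> s; apply/ler_addgt0Pr => e1 e10.
  have /cvgrPdist_lt/(_ _ e10)/(qW s N)[z [Wz fz]] := cf (q s).
  apply: le_trans (ler_distD (f z) _ _) _; rewrite addrC lerD ?cN//.
  exact: ltW.
have PS k : `|\int[P k]_y f y - S (p k)| <= e / 3.
  have -> : S (p k) = \sum_w c w * fine (P k (code B ^~ N @^-1` [set w])).
    by apply: eq_bigr => w _; rewrite -cell_tupleE.
  apply: Rintegral_step_approx => //.
  - by move=> w; rewrite -cell_tupleE; exact: measurable_cell.
  - exact: continuous_integrable.
  - by move=> y; apply: cN; rewrite (cell_tupleE B (code B y N)).
have : S (p (phi k)) @[k --> \oo] --> S m.
  by apply: cvg_big => [|w _]; [exact: add_continuous | apply: cvgMl_tmp; exact: pm].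
move=> /cvgrPdist_le/(_ _ e30); apply: filterS => k Sk.
have := PS (phi k); move: muS Sk; rewrite !ler_norml; lra.
Qed.

End weak_compactness.

Lemma id_continuous (T : topologicalType) : continuous (@id T).
Proof. by move=> x; exact: cvg_id. Qed.

(** * Euclidean structure *)

Section euclidean.
Context {R : realType} {d : nat}.
Implicit Types p q v : 'rV[R]_d.

Lemma dotZr k p q : dot p (k *: q) = k * dot p q.
Proof. by rewrite mulr_sumr; apply: eq_bigr => i _; rewrite mxE mulrCA. Qed.

Lemma dotZl k p q : dot (k *: p) q = k * dot p q.
Proof. by rewrite mulr_sumr; apply: eq_bigr => i _; rewrite mxE mulrA. Qed.

Lemma dotNr p q : dot p (- q) = - dot p q.
Proof. by rewrite -scaleN1r dotZr mulN1r. Qed.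

Lemma dot_ge0 p : 0 <= dot p p.
Proof. by apply: sumr_ge0 => i _; rewrite -expr2 sqr_ge0. Qed.

Lemma enorm_ge0 p : 0 <= enorm p. Proof. exact: sqrtr_ge0. Qed.

Lemma enorm_sqr p : enorm p ^+ 2 = dot p p.
Proof. by rewrite sqr_sqrtr// dot_ge0. Qed.

Lemma enormZ k p : enorm (k *: p) = `|k| * enorm p.
Proof.
by rewrite /enorm dotZl dotZr mulrA -expr2 sqrtrM ?sqr_ge0// sqrtr_sqr.
Qed.

Lemma enorm0 : enorm (0 : 'rV[R]_d) = 0.
Proof. by rewrite -(scale0r 0) enormZ normr0 mul0r. Qed.

Lemma dot_le p q : `|dot p q| <= (dot p p + dot q q) / 2.
Proof.
rewrite ler_norml /dot -big_split/= mulr_suml -sumrN.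
by apply/andP; split; apply: ler_sum => i _;
   have := sqr_ge0 (p 0 i - q 0 i); have := sqr_ge0 (p 0 i + q 0 i);
   rewrite sqrrB sqrrD; lra.
Qed.

Lemma normr_coord p i : `|p 0 i| <= `|p|.
Proof.
rewrite [leRHS]/Num.norm /= mx_normrE.
by apply/bigmax_geP; right => /=; exists (0, i).
Qed.

Lemma normr_le_coord p r : 0 <= r -> (forall i, `|p 0 i| <= r) -> `|p| <= r.
Proof.
move=> r0 pr; rewrite [leLHS]/Num.norm /= mx_normrE.
by apply/bigmax_leP; split => // -[i j] _ /=; rewrite ord1.
Qed.

Lemma normr_le_enorm p : `|p| <= enorm p.
Proof.
apply: normr_le_coord => [|i]; first exact: enorm_ge0.
rewrite -(@ler_pXn2r _ 2) ?nnegrE ?enorm_ge0// enorm_sqr real_normK ?num_real//.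
rewrite /dot (bigD1 i)//= -expr2 lerDl.
by apply: sumr_ge0 => j _; rewrite -expr2 sqr_ge0.
Qed.

Lemma enorm_gt0 p : p != 0 -> 0 < enorm p.
Proof. by rewrite -normr_gt0 => /lt_le_trans; apply; exact: normr_le_enorm. Qed.

Lemma dot_le_normr p : dot p p <= d%:R * `|p| ^+ 2.
Proof.
rewrite mulr_natl -[X in _ *+ X]card_ord -sumr_const; apply: ler_sum => i _.
rewrite -expr2 -[leLHS]real_normK ?num_real//.
by rewrite ler_pXn2r ?nnegrE//; exact: normr_coord.
Qed.

Lemma continuous_dot (T : topologicalType) (f g : T -> 'rV[R]_d) :
  continuous f -> continuous g -> continuous (fun t => dot (f t) (g t)).
Proof.
move=> cf cg t; apply: cvg_big => [|i _]; first exact: add_continuous.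
have cc (h : T -> 'rV[R]_d) : continuous h -> h x 0 i @[x --> t] --> h t 0 i.
  by move=> ch; exact: (continuous_comp (ch t) (@coord_continuous _ _ _ 0 i (h t))).
by apply: cvgM; exact: cc.
Qed.

Lemma continuous_enorm (T : topologicalType) (f : T -> 'rV[R]_d) :
  continuous f -> continuous (fun t => enorm (f t)).
Proof.
move=> cf t; apply: (@continuous_comp _ _ _ (fun t => dot (f t) (f t)) Num.sqrt).
  exact: continuous_dot.
exact: sqrt_continuous.
Qed.

Lemma continuous_subr (T : topologicalType) (f : T -> 'rV[R]_d) v :
  continuous f -> continuous (fun t => f t - v).
Proof. by move=> cf t; apply: cvgB; [exact: cf | exact: cvg_cst]. Qed.

End euclidean.

(** * Topology of the torus *)

Section torus_topology.
Context {R : realType} {d : nat}.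
Implicit Types (a b c : 'rV[R]_d) (y : torus R d).
Local Notation pi := (@torus_pi R d).

Lemma torus_piP a b : pi a = pi b <-> forall i, a 0 i - b 0 i \is a Num.int.
Proof.
split => [/eqmodP/forallP//|ab]; apply/eqmodP; exact/forallP.
Qed.

Lemma torus_piD a b c : pi a = pi b -> pi (c + (a - b)) = pi c.
Proof.
move=> /torus_piP ab; apply/torus_piP => i.
by rewrite !mxE addrAC subrr add0r; exact: ab.
Qed.

Lemma torus_repr y : pi (repr y) = y.
Proof. exact: reprK. Qed.

Lemma torus_pi_continuous : continuous pi.
Proof. exact: pi_continuous. Qed.

Lemma torus_continuousP (Z : topologicalType) (f : torus R d -> Z) :
  continuous f <-> continuous (f \o pi).
Proof. exact: quotient_continuous. Qed.

(** A point equivalent to one of [U] can be translated into [U] together with a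
    whole ball. *)
Lemma torus_pi_open (U : set 'rV[R]_d) : open U -> open (pi @` U).
Proof.
move=> oU; rewrite /open /= /quotient_open /= openE => a [b Ub ba].
have /nbhs_ballP[r /= r0 rU] : nbhs b U by exact: open_nbhs_nbhs.
apply/nbhs_ballP; exists r => //= a'; rewrite -ball_normE /= => aa'.
exists (b + (a' - a)); last by rewrite addrCA; exact: torus_piD.
by apply: rU; rewrite -ball_normE /= opprD addrA subrr add0r opprB.
Qed.

Lemma torus_lift y : exists2 a, pi a = y & forall i, 0 <= a 0 i <= 1.
Proof.
exists (\row_i (repr y 0 i - (Num.floor (repr y 0 i))%:~R)).
  rewrite -[RHS]torus_repr; apply/torus_piP => i; rewrite !mxE addrAC subrr add0r.
  by rewrite rpredN intr_int.
move=> i; rewrite mxE subr_ge0 lerBlDr floor_le_tmp/=.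
by rewrite ltW// addrC -intrD1 lt_succ_floor.
Qed.

Lemma torus_compact : compact [set: torus R d].
Proof.
have -> : [set: torus R d] = pi @` [set a : 'rV[R]_d | forall i, `[0, 1]%classic (a ord0 i)].
  apply/esym/seteqP; split => // y _; have [a <- a01] := torus_lift y.
  by exists a => // i; rewrite /= in_itv /= a01.
apply: continuous_compact.
  by apply: continuous_subspaceT; exact: torus_pi_continuous.
by apply: (@rV_compact R d (fun=> `[0, 1]%classic)) => _; exact: segment_compact.
Qed.

Lemma rat_dense_rV a (e : R) : 0 < e -> exists q : 'rV[rat]_d,
  `|a - map_mx ratr q| < e.
Proof.
move=> e0; have e20 : 0 < e / 2 by rewrite divr_gt0.
have /choice[q qa] i : exists q : rat, a 0 i - e / 2 < ratr q < a 0 i + e / 2.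
  have [|q] := @rat_in_itvoo R (a 0 i - e / 2) (a 0 i + e / 2); first by lra.
  by rewrite in_itv; exists q.
exists (\row_i q i); apply: (@le_lt_trans _ _ (e / 2)); last by lra.
apply: normr_le_coord => [|i]; first exact: ltW.
by rewrite !mxE ler_norml; have := qa i; lra.
Qed.

Definition torus_base (n : nat) : set (torus R d) :=
  if unpickle n is Some (q, k) then
    pi @` [set a | `|a - map_mx ratr (q : 'rV[rat]_d)| < (k : nat).+1%:R^-1]
  else set0.

Lemma torus_base_open n : open (torus_base n).
Proof.
rewrite /torus_base; case: unpickle => [[q k]|]; last exact: open0.
apply: torus_pi_open; set e := _^-1.
rewrite (_ : [set _ | _] = ball (map_mx ratr q : 'rV[R]_d) e); first exact: ball_open.
by apply/seteqP; split => a /=; rewrite -ball_normE /= distrC.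
Qed.

(** The closure of the image of a ball of radius [e] lies in the image of the
    ball of radius [2 e], because nearby points of the torus have nearby
    lifts. *)
Lemma torus_base_regular (U : set (torus R d)) y : open U -> U y ->
  exists2 n, torus_base n y & closure (torus_base n) `<=` U.
Proof.
move=> oU Uy.
have : nbhs (repr y) (pi @^-1` U).
  by apply: open_nbhs_nbhs; split => //=; rewrite torus_repr.
move=> /nbhs_ballP[r /= r0 rU].
have r30 : 0 < r / 3 by rewrite divr_gt0.
have [k _ /(_ k (leqnn k)) /=] := near_infty_natSinv_lt (PosNum r30).
set e := k.+1%:R^-1 => /= er; have {}er : e < r / 3 by exact: er.
have e0 : 0 < e by rewrite invr_gt0 ltr0n.
have [q qy] := rat_dense_rV (repr y) e0.
exists (pickle (q, k)); rewrite /torus_base pickleK.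
  by exists (repr y) => //; exact: torus_repr.
move=> z clz; pose c := repr z.
have [] := clz (pi @` ball c e).
  apply: open_nbhs_nbhs; split; first by apply: torus_pi_open; exact: ball_open.
  by exists c; [exact: ballxx | exact: torus_repr].
move=> _ [[b /= bq <-] [c' cc' cb]].
have <- : pi (c + (b - c')) = z by rewrite -[RHS]torus_repr; exact: torus_piD.
apply: rU; rewrite -ball_normE /=; move: cc'; rewrite -ball_normE /= => cc'.
rewrite (_ : _ - _ = (repr y - map_mx ratr q) - (b - map_mx ratr q) - (c - c')).
  have := ler_normB (repr y - map_mx ratr q - (b - map_mx ratr q)) (c - c').
  have := ler_normB (repr y - map_mx ratr q) (b - map_mx ratr q).
  by move: qy bq cc' er; rewrite -/e; lra.
by apply/rowP => i; rewrite !mxE; ring.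
Qed.

End torus_topology.

(** * Upper and lower limits *)

Lemma limf_esup_near (R : realType) (T : choiceType) (X : filteredType T)
    (f : X -> \bar R) (F : set_system X) {FF : Filter F} (x : \bar R) :
  (limf_esup f F < x)%E -> \forall t \near F, (f t < x)%E.
Proof.
rewrite limf_esupE => /ereal_inf_lt[_ [V FV <-] supx].
apply: filterS FV => t Vt; apply: le_lt_trans supx.
by apply: ereal_sup_ubound; exists t.
Qed.

Lemma limf_esup_le (R : realType) (T : choiceType) (X : filteredType T)
    (f : X -> \bar R) (F : set_system X) (x : \bar R) : 
  (\forall t \near F, (f t <= x)%E) -> (limf_esup f F <= x)%E.
Proof.
move=> fx; rewrite limf_esupE; apply: ereal_inf_le.
exists (ereal_sup (f @` [set t | (f t <= x)%E])); first by exists [set t | (f t <= x)%E].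
by apply: ge_ereal_sup => _ [t ? <-].
Qed.

Lemma le_limf_esup (R : realType) (T : choiceType) (X : filteredType T)
    (f : X -> \bar R) (F : set_system X) (x : \bar R) : 
  (forall V, F V -> exists2 t, V t & (x <= f t)%E) -> (x <= limf_esup f F)%E.
Proof.
move=> xf; rewrite limf_esupE; apply: le_ereal_inf_tmp => _ [V FV <-].
have [t Vt xt] := xf V FV; apply: le_trans xt _.
by apply: ereal_sup_ubound; exists t.
Qed.

Lemma limf_esup_frequently (R : realType) (T : choiceType) (X : filteredType T)
    (f : X -> \bar R) (F : set_system X) (x : \bar R) :
  (x < limf_esup f F)%E -> forall W, F W -> exists2 t, W t & (x < f t)%E.
Proof.
rewrite limf_esupE => xf W FW.
have : (x < ereal_sup (f @` W))%E.
  by apply: lt_le_trans xf _; apply: ereal_inf_lbound; exists W.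
by move=> /ereal_sup_gt[_ [t Wt <-] xt]; exists t.
Qed.

Section liminf.
Context {R : realType}.
Local Open Scope ereal_scope.

Lemma limn_einf_le (f : (\bar R)^nat) x : (forall n, f n <= x) -> limn_einf f <= x.
Proof.
move=> fx; rewrite /limn_einf leeNl; apply: le_limf_esup => V [n _ nV].
by exists n; [exact: nV (leqnn n) | rewrite leeN2].
Qed.

Lemma le_limn_einf (f : (\bar R)^nat) (g : R^nat) (x : R) :
  (forall n, (g n)%:E <= f n) -> g @ \oo --> x -> x%:E <= limn_einf f.
Proof.
move=> gf gx; rewrite /limn_einf leeNr; apply/lee_addgt0Pr => e e0.
apply: limf_esup_le.
move/cvgrPdist_le : gx => /(_ _ e0); apply: filterS => n.
rewrite ler_norml => xg; apply: (@le_trans _ _ (- (g n)%:E)); first by rewrite leeN2.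
by rewrite -!EFinN -EFinD lee_fin; lra.
Qed.

Lemma measurable_fun_limn_einf d (T : measurableType d) (D : set T)
    (f : (T -> \bar R)^nat) : (forall n, measurable_fun D (f n)) ->
  measurable_fun D (fun t => limn_einf (f ^~ t)).
Proof.
move=> mf; apply: (@measurableT_comp _ _ _ _ _ _ (@oppe R)) => //.
by apply: measurable_fun_limn_esup => n; exact: measurableT_comp.
Qed.

End liminf.

(** * Superdifferentials of semiconcave functions *)

Section superdifferential.
Context {R : realType} {d : nat}.
Implicit Types (a b p w : 'rV[R]_d) (y : torus R d) (u : torus R d -> R).
Local Notation pi := (@torus_pi R d).

Definition semiconcave_with (C : R) u := forall a b (l : R), 0 <= l <= 1 ->
  l * periodic_ext u a + (1 - l) * periodic_ext u b
    - periodic_ext u (l *: a + (1 - l) *: b)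
  <= C / 2 * l * (1 - l) * enorm (a - b) ^+ 2.

(** Semiconcavity makes the local inequality defining a superdifferential global
    at the price of a quadratic term: along the segment from [repr y] to [b] the
    difference quotient at parameter [l] dominates the one at [l = 1], up to that
    term, and the superdifferential bounds it as [l] tends to 0. *)
Lemma superdiff_repr C u y p : 0 < C -> semiconcave_with C u ->
  superdiff u y p <-> forall b, periodic_ext u b <= periodic_ext u (repr y) +
    dot p (b - repr y) + C / 2 * enorm (b - repr y) ^+ 2.
Proof.
move=> C0 uC; set a := repr y; set U := periodic_ext u; split => [up b|up].
  have [->|ba] := eqVneq b a.
    by rewrite subrr enorm0 /dot big1 ?expr0n ?mulr0 ?addr0// => i _; rewrite mxE mulr0.
  pose w := b - a; have w0 : w != 0 by rewrite subr_eq0.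
  have nw := enorm_gt0 w0.
  apply/ler_addgt0Pr => e e0; have ew : 0 < e / enorm w by rewrite divr_gt0.
  have lt0e : (limf_esup (fun b => (diff_quotient U p a b)%:E) a^' < (e / enorm w)%:E)%E.
    by apply: le_lt_trans up _; rewrite lte_fin.
  have /nbhs_ballP[r /= r0 ar] : nbhs a [set t | t != a ->
      ((diff_quotient U p a t)%:E < (e / enorm w)%:E)%E].
    exact: limf_esup_near lt0e.
  (* small enough for the point at parameter l to be in the ball of radius r *)
  pose l := Num.min (2^-1) (r / 2 / `|w|).
  have w0' : 0 < `|w| by rewrite normr_gt0.
  have l0 : 0 < l by rewrite lt_min invr_gt0 ltr0n/= !divr_gt0.
  have l1 : l <= 2^-1 by rewrite ge_min lexx.
  have lr : l * `|w| <= r / 2 by rewrite -ler_pdivlMr// ge_min lexx orbT.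
  have lw : ball a r (a + l *: w).
    rewrite -ball_normE /= opprD addrA subrr add0r normrN normrZ gtr0_norm//.
    by lra.
  have neq : a + l *: w != a.
    by rewrite -subr_eq0 addrAC subrr add0r scaler_eq0 negb_or (gt_eqF l0) w0.
  have := ar _ lw neq; rewrite lte_fin /diff_quotient.
  rewrite (addrAC a) subrr add0r enormZ gtr0_norm// dotZr.
  rewrite ltr_pdivrMr ?mulr_gt0// => dq.
  have l01 : 0 <= l <= 1 by lra.
  have := uC b a l l01; rewrite (_ : l *: b + (1 - l) *: a = a + l *: w); last first.
    by apply/rowP => i; rewrite !mxE; ring.
  rewrite -/U -/w => sc.
  have {}dq : U (a + l *: w) - U a < l * (dot p w + e).
    move: dq; rewrite (mulrCA _ l) divfK ?gt_eqF//; lra.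
  have C2 : 0 <= C / 2 * enorm w ^+ 2 by rewrite mulr_ge0 ?sqr_ge0// divr_ge0// ltW.
  have ll : l * (1 - l) * (C / 2 * enorm w ^+ 2) <= l * (C / 2 * enorm w ^+ 2).
    by rewrite ler_wpM2r//; nra.
  have : l * (U b - U a) <= l * (dot p w + e + C / 2 * enorm w ^+ 2) by lra.
  rewrite ler_pM2l//; lra.
apply/lee_addgt0Pr => e e0; rewrite add0e; apply: limf_esup_le.
have eC : 0 < e / (C / 2) by rewrite !divr_gt0.
have near0 : \forall b \near a, enorm (b - a) < e / (C / 2).
  have : (fun b => enorm (b - a)) @ a --> enorm (a - a).
    exact: (continuous_enorm (@continuous_subr _ _ _ id a (@id_continuous _))).
  by rewrite subrr enorm0 => /cvgr_lt/(_ _ eC).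
rewrite near_withinE; near=> b => ba; rewrite lee_fin /diff_quotient.
have ba0 : 0 < enorm (b - a) by rewrite enorm_gt0// subr_eq0.
rewrite ler_pdivrMr//; have := up b; have : enorm (b - a) < e / (C / 2) by near: b.
rewrite ltr_pdivlMr ?divr_gt0// => /ltW /(ler_wpM2l (ltW ba0)); rewrite -/U -/a; lra.
Unshelve. all: end_near. Qed.

Lemma superdiffP C u y a p : 0 < C -> semiconcave_with C u -> pi a = y ->
  superdiff u y p <-> forall b, periodic_ext u b <= periodic_ext u a +
    dot p (b - a) + C / 2 * enorm (b - a) ^+ 2.
Proof.
move=> C0 uC ay; have piE : pi (repr y) = pi a by rewrite torus_repr.
have uE b : periodic_ext u (b + (repr y - a)) = periodic_ext u b.
  by rewrite /periodic_ext /= torus_piD.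
have uyE : periodic_ext u (repr y) = periodic_ext u a by rewrite /periodic_ext /= piE.
rewrite (superdiff_repr _ _ C0 uC) uyE; split => up b.
  have := up (b + (repr y - a)); rewrite uE.
  by rewrite (_ : _ - repr y = b - a)//; apply/rowP => i; rewrite !mxE; ring.
have -> : periodic_ext u b = periodic_ext u (b - (repr y - a)).
  by rewrite -(uE (b - _)) subrK.
have := up (b - (repr y - a)).
by rewrite (_ : b - (repr y - a) - a = b - repr y)//; apply/rowP => i; rewrite !mxE; ring.
Qed.

Lemma closed_superdiff C u y : 0 < C -> semiconcave_with C u ->
  closed (superdiff u y).
Proof.
move=> C0 uC.
rewrite (_ : superdiff u y = \bigcap_b [set p | periodic_ext u b -
    periodic_ext u (repr y) - C / 2 * enorm (b - repr y) ^+ 2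
    <= dot p (b - repr y)]).
  apply: closed_bigI => b _.
  apply: (@preimage_closed _ _ (fun p => dot p (b - repr y)) [set x | _ <= x]).
    move=> p _; apply: (continuous_dot (@id_continuous _)).
    exact: cst_continuous.
  exact: closed_ge.
apply/seteqP; split => p.
  by move=> /(superdiff_repr _ _ C0 uC) up b _ /=; have := up b; lra.
by move=> up; apply/(superdiff_repr _ _ C0 uC) => b; have := up b I => /=; lra.
Qed.

(** The quadratic inequalities show that superdifferentials are closed, so the
    minimal norm is attained as soon as there is a superdifferential. *)
Lemma min_superdiffP C u y p : 0 < C -> semiconcave_with C u ->
  superdiff u y p -> enorm (min_superdiff u y) <= enorm p.
Proof.
move=> C0 uC up; rewrite /min_superdiff.
set A := superdiff u y `&` [set q | enorm q <= enorm p].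
have cA : compact A.
  apply: bounded_closed_compact.
    exists (enorm p); split => [|M pM q [_ /= qp]]; first exact: num_real.
    by apply: le_trans (normr_le_enorm q) _; apply: le_trans qp (ltW pM).
  apply: closedI; first exact: closed_superdiff uC.
  apply: (@preimage_closed _ _ (@enorm R d) [set x | x <= _]); last exact: closed_le.
  by move=> q _; exact: (continuous_enorm (@id_continuous _)).
have [||q /set_mem[uq _] qmin] := @EVT_min_rV R d (@enorm R d) A _ cA.
- by exists p; split => //=.
- by apply: continuous_subspaceT; exact: (continuous_enorm (@id_continuous _)).
have ex : exists q, superdiff u y q /\
    forall q', superdiff u y q' -> enorm q <= enorm q'.
  exists q; split => // q' uq'; have [qp|/ltW] := leP (enorm q') (enorm p).
    by apply: qmin; apply/mem_set; split => //=.
  by apply: le_trans; apply: qmin; apply/mem_set; split => //=.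
exact: (getPex ex).2.
Qed.

End superdifferential.

(** * Integrals and Lipschitz bounds along a curve *)

Section time_integrals.
Context {R : realType}.
Local Notation leb := (@lebesgue_measure R).
Implicit Types v w : R -> R.

Lemma continuous_integrable_itv v a b : continuous v ->
  leb.-integrable `[a, b] (EFin \o v).
Proof.
move=> cv; apply: (@continuous_compact_integrable R v); first exact: segment_compact.
exact: continuous_subspaceT.
Qed.

Lemma Rintegral_shift v T h : 0 <= T -> continuous v ->
  \int[leb]_(t in `[0, T]) v (t - h) = \int[leb]_(t in `[- h, T - h]) v t.
Proof.
move=> T0 cv; rewrite /Rintegral; congr fine.
have D1 : derive1 (fun t : R => t - h) = cst 1.
  by apply/funext => t; rewrite derive1E derive_val subr0.
have := @integration_by_substitution_increasing R (fun t => t - h) v 0 T T0.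
rewrite sub0r D1 => ->.
- by apply: eq_integral => t _; rewrite /= mulr1.
- by move=> s t _ _; rewrite ltrD2r.
- by move=> t _; exact: cst_continuous.
- exact: is_cvg_cst.
- exact: is_cvg_cst.
- split.
  + by move=> t _; apply: derivableB.
  + by apply: cvgB; [exact: cvg_at_right_filter| exact: cvg_cst].
  + by apply: cvgB; [exact: cvg_at_left_filter| exact: cvg_cst].
- exact: continuous_subspaceT.
Qed.

(** Only the two boundary layers of width [h] survive in the difference of the
    integrals of [v] over [0, T] and over [- h, T - h]; the bound does not depend
    on [T]. *)
Lemma Rintegral_diff_le v T h m M : 0 <= T -> 0 <= h -> continuous v ->
  (forall t, m <= v t <= M) ->
  \int[leb]_(t in `[0, T]) (v t - v (t - h)) <= h * (M - m).
Proof.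
move=> T0 h0 cv vmM.
have cvh : continuous (fun t => v (t - h)).
  move=> t; apply: (@continuous_comp _ _ _ (fun t => t - h) v); last exact: cv.
  by apply: cvgB; [exact: cvg_id| exact: cvg_cst].
rewrite RintegralB//; try exact: continuous_integrable_itv.
rewrite Rintegral_shift//.
have [I IE] : exists I : R -> R -> R, forall a b,
  \int[leb]_(t in `[a, b]) v t = I a b by eexists.
have split_at x : - h <= x <= T -> I (- h) T = I (- h) x + I x T.
  move=> /andP[hx xT]; rewrite -!IE.
  have int' : leb.-integrable [set` Interval (BRight x) (BRight T)] (EFin \o v).
    apply: integrableS (continuous_integrable_itv x T cv) => //.
    exact: subset_itv_oc_cc.
  rewrite -(Rintegral_itv_obnd_cbnd int') -(@Rintegral_itvB _ v (BLeft (- h)))//.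
  - by rewrite addrC subrK.
  - exact: continuous_integrable_itv.
have itv_le a c : 0 <= c -> m * c <= I a (a + c) <= M * c.
  move=> c0; rewrite -IE.
  have cstE k : k * c = \int[leb]_(t in `[a, a + c]) (cst k) t.
    transitivity (k * fine (leb `[a, a + c]%classic)); last by rewrite Rintegral_cst.
    rewrite lebesgue_measure_itv/= lte_fin ltrDl; case: ltP => [_|c0'].
      by rewrite -EFinB /= addrAC subrr add0r.
    by rewrite (@le_anti _ _ c 0) ?c0' ?c0.
  rewrite !cstE; apply/andP; split; apply: le_Rintegral => //;
    try exact: continuous_integrable_itv;
    try by apply: continuous_integrable_itv; exact: cst_continuous.
  - by move=> t _; have /andP[] := vmM t.
  - by move=> t _; have /andP[] := vmM t.
have e0 : - h <= 0 <= T by rewrite oppr_le0 h0.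
have e1 : - h <= T - h <= T by rewrite lerDr T0 gerBl.
have := split_at _ e0; rewrite (split_at _ e1) !IE.
have /andP[+ _] := itv_le (- h) h h0; rewrite addNr.
have /andP[_ +] := itv_le (T - h) h h0; rewrite subrK.
by lra.
Qed.

End time_integrals.

(** By compactness of [0, T] one integer [n] is large enough both as a Lipschitz
    constant and for the bound to hold within distance [n.+1%:R^-1]. *)
Lemma locally_lipschitz_segment (R : realType) (W : normedModType R)
    (g : R -> W) (T : R) :
  [locally [lipschitz g t | t in `[0, +oo[%classic]] ->
  exists n : nat, forall t s, 0 <= t <= T -> 0 <= s -> `|s - t| < n.+1%:R^-1 ->
    `|g s - g t| <= n%:R * `|s - t|.
Proof.
move=> glip.
have /compact_near_coveringP/near_covering_withinP := @segment_compact R 0 T.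
move=> /(_ nat \oo (fun n t => forall s, 0 <= s -> `|s - t| < n.+1%:R^-1 ->
    `|g s - g t| <= n%:R * `|s - t|) _).
case=> [t /=|n _ gn].
  rewrite in_itv /= => /andP[t0 tT].
  have [|M [_ gM]] := glip (t, t); first by split; rewrite /= in_itv /= andbT.
  have [[U1 U2] /= [nU1 nU2] U12] := gM (`|M| + 1) (ltr_pwDr ltr01 (ler_norm M)).
  have /nbhs_ballP[r /= r0 rU] : nbhs t (U1 `&` U2) by exact: filterI.
  have r20 : 0 < r / 2 by rewrite divr_gt0.
  near=> t' n => t'T s s0 st'.
  have t'r : `|t - t'| < r / 2 by near: t'; exact: nbhsx_ballx.
  have nr : n.+1%:R^-1 < r / 2.
    by near: n; exact: (near_infty_natSinv_lt (PosNum r20)).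
  have nM : `|M| + 1 <= n%:R by near: n; exact: nbhs_infty_ger.
  have Us : ball t r s.
    rewrite -ball_normE /=; have := ler_distD t' t s; rewrite (distrC t' s).
    by move: (lt_trans st' nr) t'r => + + h; lra.
  have Ut' : ball t r t' by rewrite -ball_normE /=; lra.
  apply: le_trans (U12 (s, t') _ _) _ => /=.
  - by split => /=; [have [] := rU s Us | have [] := rU t' Ut'].
  - by move: t'T; rewrite !in_itv /= s0 => /andP[->].
  - by rewrite ler_wpM2r.
exists n => t s tT s0 st.
by apply: (gn n (leqnn n) t) => //; rewrite /= in_itv.
Unshelve. all: end_near. Qed.

(** Backward, rather than forward, difference quotients are needed below. The
    truncation at time 0 does not affect the limit since [0 < t]. *)
Lemma cvg_backward_quotient (R : realType) (W : normedModType R) (g : R -> W)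
    (t : R) (h : R^nat) : derivable g t 1 -> 0 < t -> (forall k, 0 < h k) ->
  h @ \oo --> 0 ->
  (fun k => (h k)^-1 *: (g t - g (Num.max 0 (t - h k)))) @ \oo --> 'D_1 g t.
Proof.
move=> dg t0 h0 hcvg.
have hN : (fun k => - h k) @ \oo --> 0^'.
  have hN0 : (fun k => - h k) @ \oo --> (0 : R) by rewrite -oppr0; exact: cvgN.
  move=> A nA; have [n _ hn] := hN0 _ nA; exists n => // k /hn; apply => /=.
  by rewrite oppr_eq0 gt_eqF.
have := cvg_comp _ _ hN dg; apply: cvg_trans; apply: near_eq_cvg.
have /cvgr_lt/(_ _ t0) := hcvg; apply: filterS => k hk /=.
rewrite max_r ?subr_ge0 1?ltW// invrN scaleNr -scalerN opprB.
by rewrite (_ : _ *: 1 = - h k) ?(addrC _ t)// /GRing.scale /= mulr1.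
Qed.

(** * The occupation estimate *)

(** [g] lifts a curve whose velocity is almost everywhere a superdifferential of
    [u]; [N] is the exceptional null set. *)
Section occupation_estimate.
Context {R : realType} {d : nat} {V u : torus R d -> R}.
Local Notation pi := (@torus_pi R d).
Local Notation leb := (@lebesgue_measure R).
Context {C D m M : R} {g : R -> 'rV[R]_d} {N : set R}.
Hypothesis C0 : 0 < C.
Hypothesis uC : semiconcave_with C u.
Hypothesis u_cont : continuous u.
Hypothesis u_bnd : forall y, m <= u y <= M.
Hypothesis V_cont : continuous V.
Hypothesis V_bnd : forall y, - D <= V y <= 0.
Hypothesis u_sub : forall y p, superdiff u y p -> enorm p ^+ 2 / 2 + V y <= 0.
Hypothesis g_lip : [locally [lipschitz g t | t in `[0, +oo[%classic]].
Hypothesis mN : measurable N.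
Hypothesis N0 : leb N = 0%E.
Hypothesis g_flow : forall t, ~ N t -> 0 <= t ->
  derivable g t 1 /\ superdiff u (pi (g t)) ('D_1 g t).

(** The curve stopped at negative times, so as to be continuous on the line. *)
Let c t := g (Num.max 0 t).

Lemma continuous_lift : continuous c.
Proof.
move=> t; have [n gn] := locally_lipschitz_segment (Num.max 0 t) g_lip.
have n0 : 0 < n.+1%:R :> R by [].
apply/cvgrPdist_lt => e e0.
have r0 : 0 < Num.min n.+1%:R^-1 (e / n.+1%:R) by rewrite lt_min invr_gt0 n0 divr_gt0.
have : \forall s \near t, `|t - s| < Num.min n.+1%:R^-1 (e / n.+1%:R).
  exact: nbhsx_ballx.
apply: filterS => s; rewrite lt_min => /andP[ts1].
rewrite ltr_pdivlMr// => tse.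
have maxB : `|Num.max 0 s - Num.max 0 t| <= `|t - s|.
  rewrite ler_norml; move: (ler_norm (t - s)) (ler_norm (s - t)).
  rewrite (distrC s t); case: (leP 0 s); case: (leP 0 t); lra.
rewrite distrC /c; apply: le_lt_trans (gn _ _ _ _ _) _ => //.
- by rewrite le_max lexx/= lexx.
- by rewrite le_max lexx.
- exact: le_lt_trans ts1.
apply: le_lt_trans tse; rewrite mulrC ler_pM//.
by rewrite ler_nat.
Qed.

Let v t := u (pi (c t)).

Lemma continuous_along (f : torus R d -> R) : continuous f ->
  continuous (fun t => f (pi (c t))).
Proof.
move=> /torus_continuousP cf t.
exact: (@continuous_comp _ _ _ c (f \o pi) t (@continuous_lift t) (cf (c t))).
Qed.

Lemma superdiff_dot_le a b p : superdiff u (pi a) p ->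
  dot p (a - b) <= u (pi a) - u (pi b) + C / 2 * (d%:R * `|b - a| ^+ 2).
Proof.
move=> /(superdiffP _ C0 uC erefl)/(_ b); rewrite /periodic_ext /= enorm_sqr.
have := ler_wpM2l (_ : 0 <= C / 2) (dot_le_normr (b - a)).
rewrite -(opprB b a) dotNr => /(_ (divr_ge0 (ltW C0) (ler0n _ _))); lra.
Qed.

(** The kinetic energy of the flow is bounded uniformly in time: for
    [p = 'D_1 g t], [superdiff_dot_le] bounds the product of [p] with a backward
    difference quotient of [g] by the backward difference quotient of [u] along
    the curve, up to a term of order [h]. The integrals over [0, T] of the latter
    are at most [M - m] by telescoping, while the former tend to [dot p p].
    Fatou's lemma then bounds the integral of the lower limit [Phi], a measurable
    majorant of [dot p p] up to the constant [c0].

    At the times not in [F], [- V] is at most [eta] plus half of the energy;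
    at the times in [F] it is at most [D]. Since the minimal superdifferential is
    no longer than [p], [F] consists of times at which the Hamiltonian is at most
    [- eta]. *)
Lemma occupation_estimate T eta : 0 < T -> 0 <= eta -> exists F : set R,
  [/\ measurable F, F `<=` `[0, T]%classic,
      forall t, F t -> enorm (min_superdiff u (pi (g t))) ^+ 2 / 2
                         + V (pi (g t)) + eta <= 0 &
      - (\int[leb]_(t in `[0, T]) V (pi (c t))) <=
        D * fine (leb F) + eta * T + (M - m + 1) / 2].
Proof.
move=> T0 eta0.
have [n gn] := locally_lipschitz_segment T g_lip.
pose L : R := n%:R; have L0 : 0 <= L by rewrite /L.
pose kap := C / 2 * (d%:R * L ^+ 2).
have kap0 : 0 <= kap by rewrite !mulr_ge0 ?divr_ge0 ?sqr_ge0// ltW.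
have r0 : 0 < Num.min n.+1%:R^-1 (kap * T + 1)^-1.
  rewrite lt_min !invr_gt0 ltr0n/= ltr_wpDl// mulr_ge0// ltW//.
have [n0 _ n0r] := near_infty_natSinv_lt (PosNum r0).
(* the shift by n0 makes the error term kap * h k * T at most 1 for all k *)
pose h k : R := (k + n0).+1%:R^-1.
have h0 k : 0 < h k by rewrite invr_gt0 ltr0n.
have hn k : h k < n.+1%:R^-1 /\ kap * h k * T <= 1.
  have := n0r (k + n0)%N (leq_addl _ _); rewrite /= -/(h k) lt_min => /andP[-> h1].
  split => //; move: h1; rewrite -[X in _ < X]mul1r ltr_pdivlMr; last first.
    by rewrite ltr_wpDl// mulr_ge0// ltW.
  have := h0 k; nra.
have hcvg : h @ \oo --> 0.
  have := @cvg_harmonic R; rewrite -(cvg_shiftn n0); exact.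
have D0 : 0 <= D by have /andP[] := V_bnd point; lra.
(* a lower bound of the products is - c0; adding c0 makes Fatou's lemma apply *)
pose c0 := D + d%:R * L ^+ 2 / 2.
have c00 : 0 <= c0 by rewrite addr_ge0 ?divr_ge0 ?mulr_ge0 ?sqr_ge0.
pose f k t := (v t - v (t - h k)) * (h k)^-1 + (kap * h k + c0).
(* time 0 is removed because backward quotients are truncated there *)
pose B := `[0, T]%classic `\` (N `|` [set 0]).
have mN' : measurable (N `|` [set 0 : R]) by exact: measurableU.
have mB : measurable B by exact: measurableD.
have BT t : B t -> 0 < t <= T /\ ~ N t.
  move=> [] /=; rewrite in_itv /= => /andP[t0 ->] /not_orP[Nt /eqP t0'].
  by rewrite lt_neqAle eq_sym t0' t0.
pose q k t := (h k)^-1 *: (g t - g (Num.max 0 (t - h k))).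
have quotient t k : B t ->
    dot ('D_1 g t) (q k t) <= f k t - c0 /\ 0 <= f k t.
  move=> /BT[/andP[t0 tT] Nt]; have [_ ut] := g_flow Nt (ltW t0).
  set p := 'D_1 g t in ut *; pose s := Num.max 0 (t - h k).
  have [hk _] := hn k.
  have sth : `|s - t| <= h k.
    by rewrite /s ler_norml; have := h0 k; case: (leP 0 (t - h k)); lra.
  have gst : `|g s - g t| <= L * h k.
    have t0T : 0 <= t <= T by rewrite tT ltW.
    have s0 : 0 <= s by rewrite /s le_max lexx.
    apply: le_trans (gn t s t0T s0 (le_lt_trans sth hk)) _.
    by rewrite ler_wpM2l.
  have gst2 : `|g s - g t| ^+ 2 <= L ^+ 2 * h k ^+ 2.
    by rewrite -exprMn ler_pXn2r ?nnegrE ?mulr_ge0 ?(ltW (h0 k)).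
  have vE : v t = u (pi (g t)) by rewrite /v /c max_r ?ltW.
  have qf : dot p (q k t) <= f k t - c0.
    have := superdiff_dot_le (g s) ut; rewrite /q dotZr /f vE /v /c -/s => sd.
    have Cd : 0 <= C / 2 * d%:R by rewrite mulr_ge0 ?divr_ge0// ltW.
    have {}gst2 : C / 2 * (d%:R * `|g s - g t| ^+ 2) <= kap * h k ^+ 2.
      by have := ler_wpM2l Cd gst2; rewrite /kap !mulrA.
    have {}sd : dot p (g t - g s) <= u (pi (g t)) - u (pi (g s)) + kap * h k ^+ 2.
      by apply: le_trans sd _; rewrite lerD2l.
    have hi : 0 <= (h k)^-1 by rewrite invr_ge0 ltW.
    have := ler_wpM2l hi sd.
    rewrite mulrDr (_ : _^-1 * (kap * _) = kap * h k); last by field; rewrite gt_eqF.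
    by rewrite (mulrC _^-1 (_ - _)); lra.
  split => //.
  have pp : dot p p <= 2 * D.
    by have := u_sub ut; rewrite enorm_sqr; have /andP[] := V_bnd (pi (g t)); lra.
  have qq : dot (q k t) (q k t) <= d%:R * L ^+ 2.
    apply: le_trans (dot_le_normr _) _; rewrite ler_wpM2l// ler_pXn2r ?nnegrE//.
    rewrite normrZ gtr0_norm ?invr_gt0// distrC ler_pdivrMl//.
    by rewrite mulrC.
  have := dot_le p (q k t); rewrite ler_norml /c0 in qf * => /andP[+ _].
  by lra.
have cv : continuous v := continuous_along u_cont.
have cVc : continuous (fun t => V (pi (c t))) := continuous_along V_cont.
have cdiff k : continuous (fun t => v t - v (t - h k)).
  move=> t; apply: cvgB; first exact: cv.
  apply: (@continuous_comp _ _ _ (fun t => t - h k) v); last exact: cv.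
  by apply: cvgB; [exact: cvg_id| exact: cvg_cst].
have cquot k : continuous (fun t => (v t - v (t - h k)) * (h k)^-1).
  by move=> t; apply: cvgMr_tmp; exact: cdiff.
have cf k : continuous (f k).
  by move=> t; apply: cvgD; [exact: cquot | exact: cvg_cst].
have intf k : leb.-integrable `[0, T] (EFin \o f k).
  exact: continuous_integrable_itv.
have mf k : measurable_fun B (EFin \o f k).
  apply: measurable_funS (measurable_int _ (intf k)) => //; exact: subDsetl.
pose Phi t := limn_einf (fun k => (f k t)%:E).
have mPhi : measurable_fun B Phi by exact: measurable_fun_limn_einf.
have Phi_ge t : B t -> ((dot ('D_1 g t) ('D_1 g t) + c0)%:E <= Phi t)%E.
  move=> Bt; apply: (@le_limn_einf _ _ (fun k => dot ('D_1 g t) (q k t) + c0)).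
    by move=> k; rewrite lee_fin; have [] := quotient t k Bt; lra.
  have [/andP[t0 _] Nt] := BT _ Bt; have [dg _] := g_flow Nt (ltW t0).
  apply: cvgD; last exact: cvg_cst.
  have dc : continuous (dot ('D_1 g t)).
    exact: (continuous_dot (@cst_continuous _ _ ('D_1 g t)) (@id_continuous _)).
  exact: (continuous_cvg _ (dc _) (cvg_backward_quotient dg t0 h0 hcvg)).
have Phi0 t : B t -> (0 <= Phi t)%E.
  by move=> Bt; apply: le_trans (Phi_ge t Bt); rewrite lee_fin addr_ge0 ?dot_ge0.
have lebT : leb `[0, T]%classic = T%:E.
  by rewrite lebesgue_measure_itv/= lte_fin T0 -EFinB subr0.
have lebN' : leb (N `|` [set 0]) = 0%E.
  by rewrite measureU0//; exact: lebesgue_measure_set1.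
have int_B (w : R -> R) : leb.-integrable `[0, T] (EFin \o w) ->
    (\int[leb]_(t in B) (w t)%:E = (\int[leb]_(t in `[0, T]) w t)%R%:E)%E.
  move=> intw; rewrite fineK; last by apply: integrable_fin_num.
  by rewrite (@negligible_integral _ _ _ leb _ (N `|` [set 0])).
have measurable_int_B (w : R -> R) : leb.-integrable `[0, T] (EFin \o w) ->
    measurable_fun B (fun t => (w t)%:E).
  move=> /measurable_int; apply: measurable_funS => //; exact: subDsetl.
have int_cst (k : R) : \int[leb]_(t in `[0, T]) (cst k) t = k * T.
  by rewrite Rintegral_cst// (congr1 fine lebT).
have int_le : (\int[leb]_(t in B) Phi t <= (M - m + 1 + c0 * T)%:E)%E.
  apply: (@le_trans _ _ (limn_einf (fun k => \int[leb]_(t in B) (f k t)%:E)%E)).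
    by apply: fatou => // k t Bt; rewrite lee_fin; have [] := quotient t k Bt.
  apply: limn_einf_le => k; rewrite int_B// lee_fin.
  have [_ hT] := hn k.
  have vd : \int[leb]_(t in `[0, T]) (v t - v (t - h k)) <= h k * (M - m).
    apply: Rintegral_diff_le; [exact: ltW | exact: ltW | | by move=> t; exact: u_bnd].
    exact: continuous_along.
  rewrite RintegralD//; last 2 first.
    exact: continuous_integrable_itv.
    by apply: continuous_integrable_itv; exact: cst_continuous.
  rewrite RintegralZr//; last exact: continuous_integrable_itv.
  rewrite int_cst; move: vd; move: (\int[leb]_(t in _) _) => I vd.
  have : I * (h k)^-1 <= M - m by rewrite ler_pdivrMr// mulrC.
  by move=> IM; rewrite mulrDl addrA lerD2r lerD.
pose F := B `&` [set t | (Phi t <= (c0 - 2 * eta - 2 * V (pi (c t)))%:E)%E].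
have mF : measurable F.
  apply: measurable_lee => //; apply/measurable_EFinP/measurable_funTS.
  apply: continuous_measurable_fun => t; apply: cvgB; first exact: cvg_cst.
  by apply: cvgMl_tmp; exact: cVc.
have FT : F `<=` `[0, T]%classic by move=> t [[]].
exists F; split => //.
- move=> t [Bt /= Phit]; have [/andP[t0 tT] Nt] := BT _ Bt.
  have [_ ut] := g_flow Nt (ltW t0).
  have ct : c t = g t by rewrite /c max_r// ltW.
  have : enorm ('D_1 g t) ^+ 2 + c0 <= c0 - 2 * eta - 2 * V (pi (g t)).
    by rewrite enorm_sqr -ct -lee_fin; exact: le_trans (Phi_ge t Bt) Phit.
  have := min_superdiffP C0 uC ut; rewrite -(@ler_pXn2r _ 2) ?nnegrE ?enorm_ge0//.
  by lra.
pose a t := c0 - 2 * V (pi (c t)).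
pose b t := 2 * eta + 2 * D * \1_F t.
have ca : continuous a.
  by move=> t; apply: cvgB; [exact: cvg_cst | apply: cvgMl_tmp; exact: cVc].
have inta : leb.-integrable `[0, T] (EFin \o a) by exact: continuous_integrable_itv.
have intc k : leb.-integrable `[0, T] (EFin \o cst k).
  by apply: continuous_integrable_itv; exact: cst_continuous.
have int1 : leb.-integrable `[0, T] (EFin \o \1_F).
  apply: measurable_bounded_integrable => //.
  - exact: (eq_ind_r (fun x => (x < +oo)%E) (ltry T) lebT).
  - exists 1; split => // K K1 t _ /=; rewrite indicE normr_nat.
    by apply: le_trans (ltW K1); case: (_ \in _).
have intD1 : leb.-integrable `[0, T] (EFin \o (fun t => 2 * D * \1_F t)).
  rewrite (_ : _ \o _ = fun t => ((2 * D)%:E * (\1_F t)%:E)%E); last first.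
    by apply/funext => t /=; rewrite EFinM.
  exact: integrableZl.
have intb : leb.-integrable `[0, T] (EFin \o b).
  exact: (integrableD _ (intc (2 * eta)) intD1).
(* off F, - V <= eta + energy / 2; on F, - V <= D: both are doubled here and
   shifted by c0, which is part of Phi *)
have ab t : B t -> ((a t)%:E <= (b t)%:E + Phi t)%E.
  move=> Bt; rewrite /a /b indicE.
  have VD := V_bnd (pi (c t)).
  have [tF|tF] := boolP (t \in F).
    apply: (@le_trans _ _ ((2 * eta + 2 * D * 1)%:E + c0%:E)%E).
      by rewrite -EFinD lee_fin; lra.
    rewrite leeD2l//; apply: le_trans (Phi_ge t Bt).
    by rewrite lee_fin lerDr dot_ge0.
  have : (Phi t > (c0 - 2 * eta - 2 * V (pi (c t)))%:E)%E.
    by rewrite ltNge; apply/negP => PF; move/negP: tF; apply; apply/mem_set.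
  move=> /ltW/(leeD2l (2 * eta + 2 * D * 0)%:E); apply: le_trans.
  by rewrite -EFinD lee_fin; lra.
have b0 t : 0 <= b t.
  by rewrite /b addr_ge0// ?mulr_ge0// indicE.
have : (\int[leb]_(t in B) (a t)%:E <= \int[leb]_(t in B) ((b t)%:E + Phi t))%E.
  apply: ge0_le_integral => //.
  - move=> t Bt; rewrite lee_fin /a; have := V_bnd (pi (c t)); lra.
  - exact: measurable_int_B inta.
  - by apply: emeasurable_funD => //; exact: measurable_int_B intb.
rewrite ge0_integralD//; last 2 first.
  by move=> t _; rewrite lee_fin.
  exact: measurable_int_B intb.
rewrite !int_B// => /le_trans/(_ (leeD2l _ int_le)); rewrite -EFinD lee_fin.
have intV : leb.-integrable `[0, T] (EFin \o (fun t => V (pi (c t)))).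
  exact: continuous_integrable_itv.
have int2V : leb.-integrable `[0, T] (EFin \o (fun t => 2 * V (pi (c t)))).
  by apply: continuous_integrable_itv => t; apply: cvgMl_tmp; exact: cVc.
have -> : \int[leb]_(t in `[0, T]) a t =
    c0 * T - 2 * \int[leb]_(t in `[0, T]) V (pi (c t)).
  rewrite -int_cst -RintegralZl// -RintegralB//; exact: intc.
have -> : \int[leb]_(t in `[0, T]) b t = 2 * eta * T + 2 * D * fine (leb F).
  have <- : \int[leb]_(t in `[0, T]) \1_F t = fine (leb F).
    by rewrite /Rintegral integral_indic// setIidl//; exact: FT.
  rewrite -int_cst -RintegralZl// -RintegralD//; exact: intc.
move: (\int[leb]_(t in _) _) (fine (leb F)) (c0 * T) => I J X; lra.
Qed.

End occupation_estimate.

(** * Upper densities *)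

Section upper_density.
Context {R : realType}.
Local Notation leb := (@lebesgue_measure R).
Implicit Types P Q : R -> Prop.

(** Monotonicity on arbitrary sets, on which the Lebesgue measure is defined as
    the outer measure. The sets of times in [upper_density] are compared through
    it. *)
Lemma lebesgue_measure_mono (A B : set R) : A `<=` B -> (leb A <= leb B)%E.
Proof.
move=> AB; rewrite -[leLHS]/((@wlength R idfun)^* A)%mu.
by rewrite -[leRHS]/((@wlength R idfun)^* B)%mu le_outer_measure.
Qed.

Lemma upper_density_le P Q : (forall t, 0 <= t -> P t -> Q t) ->
  (upper_density P <= upper_density Q)%E.
Proof.
move=> PQ; rewrite /upper_density [leRHS]limf_esupE.
apply: le_ereal_inf_tmp => _ [W FW <-]; rewrite limf_esupE.
apply: ereal_inf_le; eexists; first by exists W.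
apply: ge_ereal_sup => _ [T WT <-].
apply: (@le_trans _ _ ((T^-1)%:E * leb [set t | (0 <= t <= T)%R /\ Q t])%E); last first.
  by apply: ereal_sup_ubound; exists T.
have [T0|T0] := leP 0 T.
  apply: lee_wpmul2l; first by rewrite lee_fin invr_ge0.
  apply: lebesgue_measure_mono => t [/andP[t0 tT] Pt]; split; first by rewrite t0.
  exact: PQ.
have E0 (Z : R -> Prop) : [set t | (0 <= t <= T)%R /\ Z t] = set0.
  by apply/seteqP; split => t //= -[] /andP[t0 /(le_trans t0)]; rewrite leNgt T0.
by rewrite !E0.
Qed.

Lemma upper_density_gt0 P : (0 < upper_density P)%E ->
  exists2 k : R, 0 < k & forall K : R, exists T : R,
    [/\ K < T, 0 < T &
        ((k * T)%:E <= leb [set t | (0 <= t <= T)%R /\ P t])%E].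
Proof.
move=> P0.
have [k k0 kP] : exists2 k : R, 0 < k & (k%:E < upper_density P)%E.
  move: P0; case: (upper_density P) => [r| |] //; rewrite ?lte_fin.
    by move=> r0; exists (r / 2); rewrite ?lte_fin; lra.
  by move=> _; exists 1 => //; rewrite ltry.
exists k => // K.
have [|T KT kT] := limf_esup_frequently kP (W := [set T | Num.max K 0 < T]).
  by exists (Num.max K 0); split => //; exact: num_real.
move: KT; rewrite /= gt_max => /andP[KT T0]; exists T; split => //.
rewrite mulrC EFinM -lee_pdivlMl//; exact: ltW.
Qed.

End upper_density.

(** * Values of the potential and distance to its maximisers *)

Section torus_dist.
Context {R : realType} {d : nat} {V : torus R d -> R}.
Local Notation pi := (@torus_pi R d).
Hypothesis V_cont : continuous V.
Hypothesis V_max : torus_max V = 0.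

Lemma torus_bounded (f : torus R d -> R) : continuous f ->
  exists m M, forall y, m <= f y <= M.
Proof.
move=> /(continuous_bounded (@torus_compact R d))[M [Mr fM]].
exists (- (M + 1)), (M + 1) => y; rewrite -ler_norml.
by apply: (fM (M + 1)) => //; rewrite ltrDl.
Qed.

Lemma oscillation_bounds y : - oscillation V <= V y <= 0.
Proof.
have [m [M VmM]] := torus_bounded V_cont.
have hs : has_sup (range V).
  by split; [exists (V y), y | exists M => _ [z _ <-]; have /andP[] := VmM z].
have hi : has_inf (range V).
  by split; [exists (V y), y | exists m => _ [z _ <-]; have /andP[] := VmM z].
rewrite /oscillation V_max sub0r opprK; apply/andP; split.
  by apply: ge_inf; [exact: hi.2 | exists y].
by rewrite -V_max; apply: ub_le_sup; [exact: hs.2 | exists y].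
Qed.

Lemma argmax_eq0 y : argmax V y <-> V y = 0.
Proof.
split => [Vy|Vy z]; last by rewrite Vy; have /andP[] := oscillation_bounds z.
apply/le_anti; have /andP[_ ->] := oscillation_bounds y; rewrite -V_max /=.
by apply: ge_sup; [exists (V y), y | move=> _ [z _ <-]; exact: Vy].
Qed.

Lemma argmax_nonempty : argmax V !=set0.
Proof.
have [||y _ Vy] := @compact_EVT_max _ R V setT _ (@torus_compact R d).
- by exists point.
- exact: continuous_subspaceT.
by exists y => z; apply: Vy; rewrite inE.
Qed.

Lemma torus_dist_has_inf y : has_inf [set enorm (a - b) |
  a in pi @^-1` [set y] & b in pi @^-1` (argmax V)].
Proof.
have [z Mz] := argmax_nonempty; split.
  exists (enorm (repr y - repr z)), (repr y); first exact: torus_repr.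
  by exists (repr z) => //=; rewrite torus_repr.
by exists 0 => _ [a _ [b _ <-]]; exact: enorm_ge0.
Qed.

Lemma torus_dist_lt y e : torus_dist (argmax V) y < e ->
  exists a b, [/\ pi a = y, V (pi b) = 0 & enorm (a - b) < e].
Proof.
move=> /(inf_lt (torus_dist_has_inf y).1)[_ [a ay [b /argmax_eq0 Vb <-]] abe].
by exists a, b.
Qed.

Lemma torus_dist_le a b : V (pi b) = 0 ->
  torus_dist (argmax V) (pi a) <= enorm (a - b).
Proof.
move=> Vb; apply: ge_inf; first exact: (torus_dist_has_inf (pi a)).2.
by exists a => //; exists b => //; exact/argmax_eq0.
Qed.

Lemma near_torus_pi a (U : set 'rV[R]_d) : nbhs a U -> nbhs (pi a) (pi @` U).
Proof.
rewrite nbhsE => -[W [oW Wa] WU].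
apply: filterS (image_subset pi WU) _; apply: open_nbhs_nbhs; split.
  exact: torus_pi_open.
by exists a.
Qed.

(** Uniform continuity of [V] on the torus: a point close to a maximiser in the
    flat metric has lifts close to lifts of it, and one modulus serves for all
    points by compactness. *)
Lemma near_argmax_gt e : 0 < e ->
  exists2 r, 0 < r & forall y, torus_dist (argmax V) y < r -> - e < V y.
Proof.
move=> e0.
have /compact_near_coveringP := @torus_compact R d.
move=> /(_ nat \oo (fun n y => forall a b, pi a = y -> enorm (a - b) < n.+1%:R^-1 ->
  V (pi b) - V y < e) _).
case=> [y _|n _ nV]; last first.
  exists n.+1%:R^-1 => [|y /torus_dist_lt[a [b [ay Vb ab]]]].
    by rewrite invr_gt0 ltr0n.
  by have := nV n (leqnn n) y I a b ay ab; rewrite Vb; lra.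
have e20 : 0 < e / 2 by rewrite divr_gt0.
pose a0 := repr y.
have /cvgrPdist_lt/(_ _ e20) := (torus_continuousP V).1 V_cont a0.
rewrite /prop_near1 => /nbhs_ballP[r /= r0 Vr].
have r20 : 0 < r / 2 by rewrite divr_gt0.
have := near_torus_pi (nbhsx_ballx a0 _ r20); rewrite torus_repr => nearB.
near=> y' n => a b ay' ab.
have [a1 a1r a1y] : (pi @` ball a0 (r / 2)) y' by near: y'.
have nr : n.+1%:R^-1 < r / 2.
  by near: n; exact: (near_infty_natSinv_lt (PosNum r20)).
pose b1 := b + (a1 - a).
have b1E : pi b1 = pi b by apply: torus_piD; rewrite a1y.
have b1r : ball a0 r b1.
  move: a1r; rewrite -ball_normE /= => a1r.
  have := le_lt_trans (normr_le_enorm _) (lt_trans ab nr).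
  have := ler_normD (a0 - a1) (a - b).
  rewrite (_ : a0 - a1 + (a - b) = a0 - b1); first by move: a1r; lra.
  by apply/rowP => i; rewrite !mxE; ring.
have a1r' : ball a0 r a1 by apply: le_ball a1r; lra.
have := Vr b1 b1r; have := Vr a1 a1r'; rewrite /= b1E a1y !ltr_norml.
by lra.
Unshelve. all: end_near. Qed.

(** The converse separation, again by compactness: near a point where [V] is
    negative [V] stays away from 0, and near a maximiser the distance is
    small. *)
Lemma far_argmax_le r : 0 < r -> exists2 e, 0 < e &
  forall y, r <= torus_dist (argmax V) y -> V y <= - e.
Proof.
move=> r0.
have /compact_near_coveringP := @torus_compact R d.
move=> /(_ nat \oo (fun n y => - n.+1%:R^-1 < V y -> torus_dist (argmax V) y < r) _).
case=> [y _|n _ nV]; last first.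
  exists n.+1%:R^-1 => [|y]; first by rewrite invr_gt0 ltr0n.
  by rewrite leNgt => /negP yr; rewrite leNgt; apply/negP => /(nV n (leqnn n) y I).
have /andP[_] := oscillation_bounds y; rewrite le_eqVlt => /predU1P[Vy0|Vy].
  have ya0 : nbhs (repr y) [set x | enorm (x - repr y) < r].
    have : (fun x => enorm (x - repr y)) @ repr y --> enorm (repr y - repr y).
      exact: (continuous_enorm (@continuous_subr _ _ _ id _ (@id_continuous _))).
    by rewrite subrr enorm0 => /cvgr_lt/(_ _ r0).
  have := near_torus_pi ya0; rewrite torus_repr => nearB.
  near=> y' n => _.
  have [a ar <-] : (pi @` [set x | enorm (x - repr y) < r]) y' by near: y'.
  by apply: le_lt_trans (torus_dist_le _ _) ar; rewrite torus_repr.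
have nearV : \forall y' \near y, V y' < V y / 2.
  have Vy2 : V y < V y / 2 by lra.
  have : V @ y --> V y by exact: V_cont.
  by move=> /cvgr_lt/(_ _ Vy2).
have V20 : 0 < - V y / 2 by lra.
near=> y' n.
have nr : n.+1%:R^-1 < - V y / 2.
  by near: n; exact: (near_infty_natSinv_lt (PosNum V20)).
have Vy' : V y' < V y / 2 by near: y'.
by move: (n.+1%:R^-1) nr => /= e nr; lra.
Unshelve. all: end_near. Qed.

End torus_dist.

(** * Time averages and occupational measures *)

Section time_averages.
Context {R : realType} {d : nat}.
Local Notation leb := (@lebesgue_measure R).
Local Notation borel := (g_sigma_algebraType (@open (torus R d))).

(** Adding the bound [K] reduces the formula to nonnegative integrands. *)
Lemma Rintegral_uniform (T : R) (T0 : 0 < T) (w : R -> R) (K : R) : continuous w ->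
  (forall t, `|w t| <= K) ->
  \int[uniform_prob T0]_t w t = T^-1 * \int[leb]_(t in `[0, T]) w t.
Proof.
move=> cw wK.
pose U : probability (measurableTypeR R) R := uniform_prob T0.
have intU : U.-integrable setT (EFin \o w).
  apply: measurable_bounded_integrable => //.
  - by apply: le_lt_trans (ltry 1); exact: probability_le1.
  - exact: continuous_measurable_fun.
  - by exists K; split => [|M KM t _]; [exact: num_real | exact: le_trans (ltW KM)].
have intUc : U.-integrable setT (EFin \o cst K) by exact: finite_measure_integrable_cst.
have intL : leb.-integrable `[0, T] (EFin \o w) by exact: continuous_integrable_itv.
have intLc : leb.-integrable `[0, T] (EFin \o cst K).
  by apply: continuous_integrable_itv; exact: cst_continuous.
have pos : \int[U]_t (w t + cst K t) =
    T^-1 * \int[leb]_(t in `[0, T]) (w t + cst K t).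
  rewrite /Rintegral; have -> : (\int[U]_t (w t + cst K t)%:E =
      (T - 0)^-1%:E * \int[leb]_(t in `[0%R, T]) (w t + cst K t)%:E)%E.
    apply: integral_uniform.
      apply/measurable_EFinP/measurable_funD => //.
      exact: continuous_measurable_fun.
    move=> t; rewrite lee_fin /=; have := wK t; rewrite ler_norml; lra.
  rewrite subr0 fineM//; apply: integrable_fin_num => //.
  exact: (integrableD _ intL intLc).
move: pos; rewrite RintegralD// (RintegralD _ intL intLc)//.
rewrite Rintegral_cst// (congr1 fine (probability_setT U)) mulr1.
have -> : \int[leb]_(t in `[0, T]) cst K t = K * T.
  transitivity (K * fine (leb `[0, T]%classic)); first by rewrite Rintegral_cst.
  by rewrite lebesgue_measure_itv/= lte_fin T0 -EFinB subr0.
rewrite mulrDr mulrCA mulVf ?gt_eqF// mulr1; exact: addIr.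
Qed.

(** A Chebyshev-type bound: the set of times where [w] is at most [- e] contains
    a set of (outer) measure [k * T]. *)
Lemma average_le_of_density (w : R -> R) (P : R -> Prop) (e k T : R) :
  continuous w -> (forall t, w t <= 0) -> 0 <= e -> 0 < T ->
  (forall t, 0 <= t -> P t -> w t <= - e) ->
  ((k * T)%:E <= leb [set t | (0 <= t <= T)%R /\ P t])%E ->
  T^-1 * \int[leb]_(t in `[0, T]) w t <= - (e * k).
Proof.
move=> cw w0 e0 T0 Pw kT.
pose A : set R := `[0, T]%classic `&` w @^-1` `]-oo, - e]%classic.
have mw : measurable_fun setT w by exact: continuous_measurable_fun.
have mA : measurable A.
  apply: measurableI => //; rewrite -[X in measurable X]setTI; exact: mw.
have AT : A `<=` `[0, T]%classic by move=> t [].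
have lebT : leb `[0, T]%classic = T%:E.
  by rewrite lebesgue_measure_itv/= lte_fin T0 -EFinB subr0.
have Afin : leb A \is a fin_num.
  rewrite ge0_fin_numE//; apply: le_lt_trans (lebesgue_measure_mono AT) _.
  by rewrite lebT ltry.
have kA : k * T <= fine (leb A).
  rewrite -lee_fin fineK//; apply: le_trans kT _; apply: lebesgue_measure_mono.
  move=> t [t0T Pt]; split; rewrite /= in_itv//=.
  by apply: Pw => //; have /andP[] := t0T.
have intw : leb.-integrable `[0, T] (EFin \o w) by exact: continuous_integrable_itv.
have int1 : leb.-integrable `[0, T] (EFin \o \1_A).
  apply: measurable_bounded_integrable => //.
  - exact: (eq_ind_r (fun x => (x < +oo)%E) (ltry T) lebT).
  - exists 1; split => // K K1 t _ /=; rewrite indicE normr_nat.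
    by apply: le_trans (ltW K1); case: (_ \in _).
have int1e : leb.-integrable `[0, T] (EFin \o (fun t => - e * \1_A t)).
  rewrite (_ : _ \o _ = fun t => ((- e)%:E * (\1_A t)%:E)%E); last first.
    by apply/funext => t /=; rewrite EFinM.
  exact: integrableZl.
have : \int[leb]_(t in `[0, T]) w t <= \int[leb]_(t in `[0, T]) (- e * \1_A t).
  apply: le_Rintegral => // t tT; rewrite indicE.
  have [|_] := boolP (t \in A); last by rewrite mulr0.
  by rewrite inE => -[_] /=; rewrite in_itv/= mulr1.
rewrite RintegralZl//.
have -> : \int[leb]_(t in `[0, T]) \1_A t = fine (leb A).
  by rewrite /Rintegral integral_indic// setIidl.
move=> wA; rewrite ler_pdivrMl//; apply: le_trans wA _.
by rewrite mulrN mulNr lerN2 mulrCA ler_wpM2l// mulrC.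
Qed.

(** The measure is the law of the curve at a uniformly distributed time. *)
Lemma time_average_exists (gamma c : R -> torus R d) (T : R) : 0 < T ->
  continuous c -> (forall t, 0 <= t -> gamma t = c t) ->
  exists nu : probability borel R, time_average gamma T nu.
Proof.
move=> T0 cc gc.
have mc : measurable_fun setT (c : R -> borel).
  apply: (@measurability _ _ _ borel _ c (@open (torus R d))) => //.
  move=> _ [W oW <-]; rewrite setTI; apply: open_measurable.
  by move/continuousP : cc; apply.
pose Q : {mfun measurableTypeR R >-> borel} := HB.pack
  (c : measurableTypeR R -> borel)
  (isMeasurableFun.Build _ _ (measurableTypeR R) borel c mc).
pose U : probability (measurableTypeR R) R := uniform_prob T0.
exists (distribution U Q) => f cf.
have [K fK] : exists K, forall y, `|f y| <= K.
  have [m [M fmM]] := torus_bounded cf; exists (Num.max (- m) M) => y.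
  rewrite ler_norml lerNl !le_max; have /andP[my yM] := fmM y.
  by rewrite lerN2 my yM orbT.
have cfc : continuous (f \o c) by move=> t; exact: continuous_comp (cc t) (cf _).
transitivity (\int[U]_t f (c t)).
  rewrite /Rintegral; congr fine; apply: integral_distribution.
    apply/measurable_EFinP; exact: continuous_borel cf.
  apply: measurable_bounded_integrable => //.
  - by apply: le_lt_trans (ltry 1); exact: probability_le1.
  - exact: (continuous_measurable_fun cfc).
  - by exists K; split => [|M KM t _]; [exact: num_real | exact: le_trans (ltW KM)].
rewrite (@Rintegral_uniform T T0 (f \o c) K)//; last by move=> t; exact: fK.
congr (_ * _); apply: eq_Rintegral => t; rewrite inE /= in_itv /= => /andP[t0 _].
by rewrite gc.
Qed.

Lemma occupational_subsequence (gamma c : R -> torus R d) (T : nat -> R) :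
  continuous c -> (forall t, 0 <= t -> gamma t = c t) ->
  (forall k, 0 < T k) -> nondecreasing_seq T -> T @ \oo --> +oo ->
  exists2 phi : nat -> nat, increasing_seq phi &
  exists2 mu : probability (torus R d) R, occupational gamma mu &
    forall f, continuous f ->
      (fun k => (T (phi k))^-1 * \int[leb]_(t in `[0, T (phi k)]) f (gamma t))
        @ \oo --> \int[mu]_y f y.
Proof.
move=> cc gc T0 Tnd Too.
have /choice[nu nuP] k := time_average_exists (T0 k) cc gc.
have [phi [mu [phi_inc mulim]]] := weak_compactness (@torus_compact R d)
  (@torus_base_open R d) (@torus_base_regular R d) nu.
have phi_mono k l : (k <= l)%N -> (phi k <= phi l)%N.
  by move=> kl; have := phi_inc k l; rewrite kl leEnat.
have phi_lt k : (phi k < phi k.+1)%N.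
  by rewrite ltnNge; have := phi_inc k.+1 k; rewrite leEnat ltnn => ->.
have phi_ge k : (k <= phi k)%N.
  by elim: k => // k IH; exact: leq_ltn_trans IH (phi_lt k).
have phi_oo : phi @ \oo --> \oo.
  by move=> A [n _ nA]; exists n => // k nk; apply: nA; exact: leq_trans nk (phi_ge k).
exists phi => //; exists mu.
  exists (T \o phi), (nu \o phi); split => //.
  - by move=> k /=.
  - by move=> k l kl; apply: Tnd; exact: phi_mono.
  - exact: (cvg_comp _ _ phi_oo Too).
  - by move=> k; exact: nuP.
move=> f cf; have := mulim f cf.
suff -> : (fun k => \int[nu (phi k)]_y f y) = (fun k =>
    (T (phi k))^-1 * \int[leb]_(t in `[0, T (phi k)]) f (gamma t)) by [].
by apply/funext => k; exact: nuP.
Qed.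

End time_averages.

(** * The three equivalent properties *)

Local Notation leb := (@lebesgue_measure _).

Theorem theorem22 (R : realType) (d : nat) (V u : torus R d -> R)
    (x : torus R d) (gamma : R -> torus R d)
    (V_C2 : class_C 2 (periodic_ext V))
    (V_max : torus_max V = 0)
    (u_sc : semiconcave u)
    (u_sol : viscosity_solution V u)
    (gamma_flow : gradient_flow u x gamma)
    (sigma_oo : critical_time u gamma = +oo%E) :
  [<-> exists2 mu : probability (torus R d) R,
         occupational gamma mu & \int[mu]_y V y < 0;
       0 < oscillation V /\
       exists2 eta : R, 0 < eta &
         ((eta / oscillation V)%:E <=
          upper_density (fun t =>
            (enorm (min_superdiff u (gamma t)) ^+ 2 / 2
              + V (gamma t) + eta <= 0)%R))%E;
       exists2 delta : R, 0 < delta &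
         (0 < upper_density (fun t =>
            (delta <= torus_dist (argmax V) (gamma t))%R))%E].
Proof.
have V_cont : continuous V by apply/torus_continuousP; have [] := V_C2.
have V_bnd := oscillation_bounds V_cont V_max.
have [u_cont [C C0 uC]] := u_sc.
have [m [M u_bnd]] := torus_bounded u_cont.
have [u_sub _] := u_sol.
have [_ [g [gammaE g_lip [N [mN N0 gN]]]]] := gamma_flow.
have g_flow t : ~ N t -> 0 <= t ->
    derivable g t 1 /\ superdiff u (torus_pi (g t)) ('D_1 g t).
  move=> Nt t0; rewrite -gammaE//; apply: contrapT => bad.
  by apply: Nt; apply: gN => /= /(_ t0).
pose c t := torus_pi (g (Num.max 0 t)).
have c_cont : continuous c.
  move=> t; exact: (continuous_comp (@continuous_lift _ _ _ g_lip t)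
    (@torus_pi_continuous _ _ _)).
have gammac t : 0 <= t -> gamma t = c t by move=> t0; rewrite gammaE// /c max_r.
have intE T : \int[@lebesgue_measure R]_(t in `[0, T]) V (gamma t) =
    \int[@lebesgue_measure R]_(t in `[0, T]) V (c t).
  apply: eq_Rintegral => t; rewrite inE /= in_itv /= => /andP[t0 _].
  by rewrite gammac.
tfae.
- move=> [mu [T [nu [T0 _ Too nuT nucvg]]] Vmu].
  have [y Vy] : exists y, V y < 0.
    apply: contrapT => noV; move: Vmu; rewrite ltNge => /negP; apply.
    apply: Rintegral_ge0 => y _; rewrite leNgt; apply/negP => Vy.
    by apply: noV; exists y.
  have osc0 : 0 < oscillation V by have /andP[] := V_bnd y; lra.
  split => //.
  (* one third of the mean of - V: one third is lost to the term eta * T of the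
     estimate below, one third to the two error terms, and one third remains *)
  pose eta := - (\int[mu]_y V y) / 3.
  have eta0 : 0 < eta by rewrite /eta; lra.
  exists eta => //; apply: le_limf_esup => W [K [_ KW]].
  pose K' := (M - m + 1) / eta.
  have eta20 : 0 < eta / 2 by lra.
  have near1 : \forall k \near \oo, `|\int[mu]_y V y - \int[nu k]_y V y| < eta / 2.
    by have /cvgrPdist_lt/(_ _ eta20) := nucvg V V_cont.
  have near2 : \forall k \near \oo, Num.max K K' < T k.
    exact: Too (nbhs_pinfty_gt (num_real _)).
  have [k [kV]] := filter_ex (filterI near1 near2).
  rewrite gt_max => /andP[KT KT']; exists (T k); first exact: KW.
  have [F [mF FT Fbad est]] := occupation_estimate C0 uC u_cont u_bnd V_cont V_bnd
    u_sub g_lip mN N0 g_flow (T0 k) (ltW eta0).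
  have Tk := T0 k.
  have Ffin : leb F \is a fin_num.
    rewrite ge0_fin_numE//; apply: le_lt_trans (lebesgue_measure_mono FT) _.
    by rewrite lebesgue_measure_itv/= lte_fin Tk -EFinB ltry.
  apply: (@le_trans _ _ ((T k)^-1%:E * leb F)%E); last first.
    apply: lee_wpmul2l; first by rewrite lee_fin invr_ge0 ltW.
    apply: lebesgue_measure_mono => t Ft.
    have := FT t Ft; rewrite /= in_itv /= => t0T; split => //.
    by rewrite gammaE; [exact: Fbad | have /andP[] := t0T].
  rewrite -(fineK Ffin) -EFinM lee_fin ler_pdivrMr// -mulrA ler_pdivlMl//.
  move: kV; rewrite (nuT k V V_cont) intE ltr_norml => /andP[kV _].
  have {}kV : (T k)^-1 * (\int[leb]_(t in `[0, T k]) V (c t)) < - (5 / 2 * eta).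
    by move: kV; rewrite /eta; lra.
  move: kV KT' est; rewrite ltr_pdivrMl// ltr_pdivrMr//.
  rewrite -/c -[X in - X <= _]/(\int[leb]_(t in `[0, T k]) V (c t)).
  move: (fine _) (\int[leb]_(t in _) _) => lF J; lra.
- move=> [osc0 [eta eta0 density]].
  have [r r0 near_max] := near_argmax_gt V_cont V_max eta0.
  exists r => //; apply: (@lt_le_trans _ _ (eta / oscillation V)%:E).
    by rewrite lte_fin divr_gt0.
  apply: le_trans density _; apply: upper_density_le => t t0 bad.
  rewrite leNgt; apply/negP => /near_max.
  by have := sqr_ge0 (enorm (min_superdiff u (gamma t))); lra.
- move=> [r r0 /upper_density_gt0[k k0 kT]].
  have [e e0 far] := far_argmax_le V_cont V_max r0.
  have /choice[pick pickP] := kT.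
  pose T := fix T n := if n is n'.+1 then pick (Num.max (T n') n'%:R) else pick 0.
  have Tpick n : exists K, T n = pick K by case: n => [|n]; eexists.
  have T0 n : 0 < T n by have [K ->] := Tpick n; have [] := pickP K.
  have T_incr n : Num.max (T n) n%:R < T n.+1.
    by have [] := pickP (Num.max (T n) n%:R).
  have Tnd : nondecreasing_seq T.
    by apply/nondecreasing_seqP => n; have := T_incr n; rewrite gt_max => /andP[/ltW].
  have Too : T @ \oo --> +oo.
    have T_ge n : n%:R - 1 <= T n.
      case: n => [|n]; first by have := T0 0%N; lra.
      by have := T_incr n; rewrite gt_max -natr1 => /andP[_]; lra.
    apply/cvgryPge => K; near=> n; apply: le_trans (T_ge n).
    by rewrite lerBrDr; near: n; exact: nbhs_infty_ger.
  have [phi _ [mu mu_occ mulim]] :=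
    occupational_subsequence c_cont gammac T0 Tnd Too.
  exists mu => //; apply: (@le_lt_trans _ _ (- (e * k))); last first.
    by rewrite oppr_lt0 mulr_gt0.
  have := mulim V V_cont; set avg := (fun k => _) => avg_lim.
  rewrite -(cvg_lim _ avg_lim)//; apply: limr_le.
    by apply/cvg_ex; eexists; exact: avg_lim.
  apply: nearW => n; rewrite /avg intE.
  apply: (average_le_of_density (P := fun t => r <= torus_dist (argmax V) (gamma t))).
  - exact: (continuous_along g_lip V_cont).
  - by move=> t; have /andP[] := V_bnd (c t).
  - exact: ltW.
  - exact: T0.
  - by move=> t t0; rewrite gammac// => /far.
  - by have [K ->] := Tpick (phi n); have [] := pickP K.
Unshelve. all: end_near. Qed.
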